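(* Let $S$ be a polynomial ring in finitely many variables over a field, and let $I$ and $J$ be two arbitrary monomial complete intersections in $S$. Then $$\operatorname{reg}(IJ) \le \operatorname{reg}(I) + \operatorname{reg}(J) \quad\text{and}\quad \operatorname{reg}(I \cap J) \le \operatorname{reg}(I) + \operatorname{reg}(J).$$
   Context: $S$ carries the standard grading (every variable has degree $1$). For a homogeneous ideal $I$ of $S$ with minimal graded free resolution $0 \to \bigoplus_j S(-b_{mj}) \to \cdots \to \bigoplus_j S(-b_{0j}) \to I \to 0$, the Castelnuovo-Mumford regularity of $I$ is $\operatorname{reg}(I) := \max_{i,j}\{b_{ij}-i \mid i=0,\dots,m\}$ (so that the unit ideal has $\operatorname{reg}(S)=0$). A monomial complete intersection is a nonzero monomial ideal that is a complete intersection, i.e. its minimal monomial generators form a regular sequence (equivalently, they are pairwise coprime). *)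

(* Defs.v *)
From mathcomp Require Import all_boot all_order all_algebra.
From mathcomp Require Import boolp classical_sets.
From mathcomp Require Import mpoly.

Set Implicit Arguments.
Unset Strict Implicit.
Unset Printing Implicit Defensive.

Import Order.TTheory GRing.Theory Num.Theory.
Local Open Scope classical_set_scope.
Local Open Scope ring_scope.

(* Ideals are sets of polynomials: the structure [idealr] of MathComp only
   covers proper decidable ideals, whereas the unit ideal is allowed here. *)

Definition ideal_span (R : comNzRingType) (A : set R) : set R :=
  [set p | exists s : seq (R * R),
     (forall cf, cf \in s -> A cf.2) /\ p = \sum_(cf <- s) cf.1 * cf.2].

Definition ideal_prod (R : comNzRingType) (I J : set R) : set R :=
  ideal_span [set f * g | f in I & g in J].

(* The quotient by the whole sequence is not required to be nonzero, so that
   the one-term sequence [:: 1] is regular and the unit ideal is a monomial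
   complete intersection. *)
Definition regular_seq (R : comNzRingType) (s : seq R) : Prop :=
  forall i, (i < size s)%N -> forall p : R,
    ideal_span [set` take i s] (s`_i * p) -> ideal_span [set` take i s] p.

Section MonomialIdeals.
Variables (K : fieldType) (n : nat).
Implicit Types (I : set {mpoly K[n]}) (m : 'X_{1..n}).

Definition monomial_ideal I : Prop :=
  exists M : set 'X_{1..n}, I = ideal_span [set 'X_[m] | m in M].

Definition min_monomial_gen I m : Prop :=
  I 'X_[m] /\ forall m', I 'X_[m'] -> (m' <= m)%MM -> m' = m.

Definition monomial_complete_intersection I : Prop :=
  [/\ monomial_ideal I,
      I <> [set 0] &
      exists g : seq 'X_{1..n},
        [/\ uniq g,
            forall m, m \in g <-> min_monomial_gen I m &
            regular_seq [seq 'X_[m] : {mpoly K[n]} | m <- g]]].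

End MonomialIdeals.

Section Regularity.
Variables (K : fieldType) (n : nat).

Definition homog_of_degree (d : int) (p : {mpoly K[n]}) : Prop :=
  p = 0 \/ exists2 e : nat, d = e%:Z & p \is e.-homog.

(* Finite complexes of finitely generated graded free modules
     F_i = \bigoplus_(j < fr_rank i) S(- fr_shift i j),
   augmented to S.  Elements of F_i are row vectors, on which the matrices act
   on the right; F_i = 0 for i > fr_length. *)
Record free_complex := FreeComplex {
  fr_length : nat;
  fr_rank : nat -> nat;
  fr_shift : forall i, 'I_(fr_rank i) -> int;
  fr_diff : forall i, 'M[{mpoly K[n]}]_(fr_rank i.+1, fr_rank i);
  fr_aug : 'cV[{mpoly K[n]}]_(fr_rank 0);
  fr_bounded : forall i, (fr_length < i)%N -> fr_rank i = 0%N
}.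

(* The maps have degree 0: the j-th basis element of F_i lives in degree
   fr_shift i j. *)
Definition graded_complex (F : free_complex) : Prop :=
  (forall k, homog_of_degree (fr_shift k) (fr_aug F k 0)) /\
  (forall i j k,
     homog_of_degree (fr_shift j - fr_shift k) (fr_diff F i j k)).

Definition resolves (F : free_complex) (I : set {mpoly K[n]}) : Prop :=
  [/\ forall p, I p <-> exists v : 'rV_(fr_rank F 0), (v *m fr_aug F) 0 0 = p,
      forall v : 'rV_(fr_rank F 0),
        v *m fr_aug F = 0 <-> exists w, v = w *m fr_diff F 0 &
      forall i (v : 'rV_(fr_rank F i.+1)),
        v *m fr_diff F i = 0 <-> exists w, v = w *m fr_diff F i.+1].

(* d(F_(i+1)) is contained in (x_1, ..., x_n) F_i. *)
Definition minimal_complex (F : free_complex) : Prop :=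
  forall i j k, (fr_diff F i j k)@_0 = 0.

Definition minimal_graded_free_resolution
    (F : free_complex) (I : set {mpoly K[n]}) : Prop :=
  [/\ graded_complex F, resolves F I & minimal_complex F].

Definition is_regularity (I : set {mpoly K[n]}) (r : int) : Prop :=
  exists F : free_complex,
    [/\ minimal_graded_free_resolution F I,
        exists i (j : 'I_(fr_rank F i)), r = fr_shift j - i%:Z &
        forall i (j : 'I_(fr_rank F i)), fr_shift j - i%:Z <= r].

(* Every nonzero homogeneous ideal has a minimal graded free resolution, unique
   up to isomorphism, hence exactly one r with [is_regularity I r]; the default
   value 0 is only reached for other sets, such as the zero ideal. *)
Definition reg (I : set {mpoly K[n]}) : int :=
  xget 0 [set r | is_regularity I r].

End Regularity.

(* Main.v *)
(** Since Tor_i(K, I) of a monomial ideal I is computed by the Koszul complex of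
    the variables with coefficients in I, the bound [reg I <= r] amounts to the
    exactness, in the multidegrees c with |c| > r + i, of i-chains of simplicial
    complexes attached to the set U of monomials of I.  In this form the bound
    is immediate for principal ideals, is shifted by multiplication by a
    monomial, and satisfies a Mayer-Vietoris rule: it holds for the union of U
    and V if it holds for U and for V, and with r + 1 for their intersection.

    Let I = (f_1, ..., f_a) and J = (g_1, ..., g_b) have coprime generators, so
    that reg I = sum_i (deg f_i - 1) + 1 by the Koszul resolution.  Applying the
    Mayer-Vietoris rule to the unions over the f_i and the g_j reduces the
    intersection of I and J to principal ideals.  For IJ, the union of the f_i J,
    the rule leads to the intersection of the f_i J over a nonempty set B of
    indices, which is the product of f_B := prod_(i in B) f_i and of the
    intersection over i in B of the ideals (e_j c_ij : j), where
    e_j = g_j / gcd(g_j, f_B) and c_ij = gcd(g_j, f_i).  The regularity of the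
    latter is at most reg J, by splitting off the e_j one at a time. *)

Require Import Defs.
From mathcomp Require Import boolp classical_sets.
From mathcomp Require Import all_boot all_order all_algebra.
From mathcomp Require Import mpoly.
From mathcomp Require Import zify ring.

Set Implicit Arguments.
Unset Strict Implicit.
Unset Printing Implicit Defensive.

Import Order.TTheory GRing.Theory Num.Theory.
Local Open Scope ring_scope.

(** * The Koszul differential *)

Section KoszulDifferential.
Variables (R : comNzRingType) (N : nat).
Implicit Types (k l : 'I_N) (a : 'I_N -> R) (z : {set 'I_N} -> R) (A : {set 'I_N}).

Definition ksign (k : 'I_N) A : R := (-1) ^+ #|[set l in A | (l < k)%N]|.

(** A chain is the function [z] of its coefficients on the basis elements indexed by subsets; this
    is the coefficient at [A] of its Koszul boundary. For [a] constantly 1 it is the augmented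
    simplicial boundary. *)
Definition kdiff a z A : R :=
  \sum_(k | k \notin A) ksign k A * a k * z (k |: A).

Lemma ksign_sqr k A : ksign k A * ksign k A = 1.
Proof. by rewrite /ksign -expr2 sqrr_sign. Qed.

Lemma ksignU_lt k l A : (k < l)%N -> k \notin A ->
  ksign l (k |: A) = - ksign l A.
Proof.
move=> kl kA; rewrite /ksign.
have -> : [set j in k |: A | (j < l)%N] = k |: [set j in A | (j < l)%N].
  by apply/setP => j; rewrite !inE; case: eqVneq => [->|].
by rewrite cardsU1 inE (negbTE kA) /= add1n exprS mulN1r.
Qed.

Lemma ksignU_gt k l A : (l < k)%N -> ksign l (k |: A) = ksign l A.
Proof.
move=> lk; rewrite /ksign; congr (_ ^+ #|pred_of_set _|).
apply/setP => j; rewrite !inE; case: eqVneq => [->|//].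
by rewrite [(k < l)%N]ltnNge (ltnW lk) /= andbF.
Qed.

Lemma ksign_swap k l A : k != l -> k \notin A -> l \notin A ->
  ksign l A * ksign k (l |: A) = - (ksign k A * ksign l (k |: A)).
Proof.
rewrite -val_eqE neq_ltn => /orP[] kl kA lA.
- by rewrite (ksignU_lt kl kA) (ksignU_gt _ kl) mulrN opprK mulrC.
- by rewrite (ksignU_lt kl lA) (ksignU_gt _ kl) mulrN mulrC.
Qed.

Lemma eq_kdiff a z z' A :
  (forall k, k \notin A -> z (k |: A) = z' (k |: A)) ->
  kdiff a z A = kdiff a z' A.
Proof. by move=> e; apply: eq_bigr => k kA; rewrite e. Qed.

Lemma kdiff0 a z A :
  (forall k, k \notin A -> z (k |: A) = 0) -> kdiff a z A = 0.
Proof. by move=> e; apply: big1 => k kA; rewrite e ?mulr0. Qed.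

Lemma kdiffB a z z' A :
  kdiff a (fun B => z B - z' B) A = kdiff a z A - kdiff a z' A.
Proof. by rewrite -sumrB; apply: eq_bigr => k _; rewrite mulrBr. Qed.

Lemma kdiffD a z z' A :
  kdiff a (fun B => z B + z' B) A = kdiff a z A + kdiff a z' A.
Proof. by rewrite -big_split; apply: eq_bigr => k _; rewrite mulrDr. Qed.

Lemma kdiff_sum (I : finType) a (z : I -> {set 'I_N} -> R) (b : I -> R) A :
  kdiff a (fun B => \sum_i z i B * b i) A = \sum_i kdiff a (z i) A * b i.
Proof.
rewrite /kdiff.
under [RHS]eq_bigr => i _ do rewrite mulr_suml.
rewrite exchange_big; apply: eq_bigr => k _; rewrite mulr_sumr.
by apply: eq_bigr => i _; rewrite mulrA.
Qed.

(** The terms for [(k, l)] and [(l, k)] cancel by [ksign_swap]: the double sum is cut along [k < l]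
    and folded onto itself. *)
Lemma kdiff_kdiff a z A : kdiff a (kdiff a z) A = 0.
Proof.
rewrite /kdiff.
under eq_bigr => k _ do rewrite mulr_sumr.
rewrite pair_big_dep /= (bigID (fun p : 'I_N * 'I_N => (p.1 < p.2)%N)) /=.
rewrite [X in _ + X](reindex_inj (h := fun p : 'I_N * 'I_N => (p.2, p.1))) /=;
  last by move=> [? ?] [? ?] [-> ->].
rewrite [X in _ + X](eq_bigl (fun p : 'I_N * 'I_N =>
  (p.1 \notin A) && (p.2 \notin p.1 |: A) && (p.1 < p.2)%N)); last first.
  move=> [k l] /=; rewrite !inE !negb_or -leqNgt -!val_eqE /=.
  by case: (k \in A); case: (l \in A); rewrite /= ?andbF //; case: ltngtP.
rewrite -big_split big1 //= => -[k l] /= /andP[/andP[kA]].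
rewrite in_setU1 negb_or => /andP[lk lA] kl.
rewrite eq_sym in lk.
rewrite setUCA !mulrA -mulrDl.
rewrite [X in X * _](_ : _ = 0) ?mul0r //.
have -> : ksign l A * a l * ksign k (l |: A) * a k =
  ksign l A * ksign k (l |: A) * a l * a k by ring.
by rewrite (ksign_swap lk kA lA); ring.
Qed.

(* Contracting homotopy of the simplex on [D], coning off from a vertex of D. *)
Lemma simplex_acyclic (D : {set 'I_N}) i z :
    (0 < i)%N || (D != set0) ->
    (forall A, z A != 0 -> (#|A| == i) && (A \subset D)) ->
    (forall A, kdiff (fun=> 1) z A = 0) ->
  exists2 w, (forall A, w A != 0 -> (#|A| == i.+1) && (A \subset D)) &
    forall A, kdiff (fun=> 1) w A = z A.
Proof.
move=> iD suppz dz.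
case: (set_0Vmem D) suppz iD => [-> | [k0 k0D]] suppz iD.
  move: iD; rewrite eqxx orbF => i0; exists (fun=> 0) => A; first by rewrite eqxx.
  rewrite kdiff0 //; case: (eqVneq (z A) 0) => [-> // | /suppz].
  by rewrite subset0 => /andP[/eqP cA /eqP A0]; rewrite -cA A0 cards0 in i0.
exists (fun A => if k0 \in A then ksign k0 (A :\ k0) * z (A :\ k0) else 0).
  move=> A; case: ifP => [k0A|]; last by rewrite eqxx.
  move=> nz; have /suppz : z (A :\ k0) != 0.
    by apply: contraNneq nz => ->; rewrite mulr0.
  rewrite (cardsD1 k0 A) k0A add1n eqSS => /andP[-> /= /subsetP sub].
  apply/subsetP => j jA; case: (eqVneq j k0) => [-> //| jk0].
  by apply: sub; rewrite !inE jk0.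
move=> A; case: (boolP (k0 \in A)) => k0A; last first.
  rewrite /kdiff (bigD1 k0) //= big1 ?addr0 => [|k /andP[kA kk0]].
    by rewrite setU11 setU1K // mulr1 mulrA ksign_sqr mul1r.
  by rewrite !inE (negbTE k0A) eq_sym (negbTE kk0) mulr0.
have [k0A' defA] : k0 \notin A :\ k0 /\ k0 |: (A :\ k0) = A.
  by rewrite setD1K // setD11.
set A' := A :\ k0 in k0A' defA *.
have := dz A'; rewrite /kdiff (bigD1 k0) //= defA mulr1 => dzA.
(* The cycle condition at [A'] expresses [z A] through the sets [k |: A'] with [k != k0], which are
   those met by the boundary of the cone at [A]. *)
transitivity (- ksign k0 A' * \sum_(k | (k \notin A') && (k != k0))
   ksign k A' * 1 * z (k |: A')); last first.
  have -> : \sum_(k | (k \notin A') && (k != k0)) ksign k A' * 1 * z (k |: A')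
    = - (ksign k0 A' * z A) by apply/eqP; rewrite -addr_eq0 addrC dzA.
  by rewrite mulrNN mulrA ksign_sqr mul1r.
rewrite mulr_sumr; apply: eq_big => [k|k kA].
  rewrite -defA !inE negb_or andbC; congr (_ && _); by rewrite !inE.
have kk0 : k != k0 by apply: contraNneq kA => ->.
have kA' : k \notin A' by rewrite !inE negb_and kA orbT.
have e : (k |: A) :\ k0 = k |: A'.
  by apply/setP => j; rewrite !inE; case: (eqVneq j k) => [->|]; rewrite ?kk0.
rewrite !inE k0A orbT e !mulr1 !mulrA; congr (_ * _).
have := ksign_swap kk0 kA' k0A'; rewrite defA => h.
transitivity (ksign k0 A' * (ksign k0 A' * ksign k A) * ksign k0 (k |: A')).
  by rewrite mulrA ksign_sqr mul1r.
rewrite h; transitivity (- ksign k0 A' * ksign k A' *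
  (ksign k0 (k |: A') * ksign k0 (k |: A'))); first by ring.
by rewrite ksign_sqr mulr1.
Qed.

End KoszulDifferential.

(** * Multigraded strands and Mayer-Vietoris *)

Section MultigradedChains.
Variables (K : fieldType) (n N : nat) (f : 'I_N -> 'X_{1..n}).
Implicit Types (U V : 'X_{1..n} -> bool) (c m : 'X_{1..n}) (i : nat)
  (z w : {set 'I_N} -> K) (A : {set 'I_N}).

Definition label A : 'X_{1..n} := (\sum_(k in A) f k)%MM.

Lemma labelU1 k A : k \notin A -> label (k |: A) = (f k + label A)%MM.
Proof. exact: big_setU1. Qed.

(** When [f] lists the variables, these are the faces with [i] elements of the upper Koszul
    simplicial complex of [U] in multidegree [c]. *)
Definition face U c i A : bool :=
  [&& #|A| == i, (label A <= c)%MM & U (c - label A)%MM].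

Definition acyclic_at U c i : Prop :=
  forall z, (forall A, z A != 0 -> face U c i A) ->
    (forall A, kdiff (fun=> 1) z A = 0) ->
  exists2 w, (forall A, w A != 0 -> face U c i.+1 A) &
    forall A, kdiff (fun=> 1) w A = z A.

Definition upset U : Prop := forall m m', (m <= m')%MM -> U m -> U m'.

Lemma eq_acyclic_at U V c c' i :
    (forall j A, face U c j A = face V c' j A) ->
  acyclic_at U c i -> acyclic_at V c' i.
Proof.
move=> e acU z supz dz; have [|w supw dw] := acU z _ dz.
  by move=> A /supz; rewrite e.
by exists w => // A /supw; rewrite e.
Qed.

Lemma acyclic_at_noface U c i :
  (forall A, ~~ face U c i A) -> acyclic_at U c i.
Proof.
move=> nof z supz dz; exists (fun=> 0) => A; first by rewrite eqxx.
rewrite kdiff0 //; case: (eqVneq (z A) 0) => [-> //|/supz].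
by rewrite (negbTE (nof A)).
Qed.

Lemma acyclic_at_simplex U c i (D : {set 'I_N}) :
    (forall j A, face U c j A = (#|A| == j) && (A \subset D)) ->
  (0 < i)%N || (D != set0) -> acyclic_at U c i.
Proof.
move=> e iD z supz dz.
have [|w supw dw] := simplex_acyclic iD _ dz; first by move=> A /supz; rewrite e.
by exists w => // A /supw; rewrite e.
Qed.

Lemma lem_sub2l (m1 m2 m : 'X_{1..n}) :
  (m1 <= m2)%MM -> (m - m2 <= m - m1)%MM.
Proof.
by move=> /mnm_lepP h; apply/mnm_lepP => j; rewrite !mnmBE leq_sub2l.
Qed.

Lemma face_del U c i k A : upset U -> k \notin A ->
  face U c i.+1 (k |: A) -> face U c i A.
Proof.
move=> upU kA /and3P[cA lA UA]; move: cA lA UA; rewrite labelU1 // => cA lA UA.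
have le : (label A <= f k + label A)%MM by rewrite lem_addl.
apply/and3P; split; first by move: cA; rewrite cardsU1 kA.
- exact: lepm_trans le lA.
- by apply: upU UA; apply: lem_sub2l.
Qed.

Lemma kdiff_face U c i z : upset U ->
    (forall A, z A != 0 -> face U c i.+1 A) ->
  forall A, kdiff (fun=> 1) z A != 0 -> face U c i A.
Proof.
move=> upU supz A; apply: contraR => nf; rewrite kdiff0 // => k kA.
by apply: contraNeq nf => /supz; apply: face_del.
Qed.

(** The cycle is split as [zU + zV]. The boundary of [zU], opposite to that of [zV], is a cycle of
    the intersection; a filling [w0] of it there turns both halves into cycles [zU - w0] and
    [zV + w0]. *)
Lemma acyclic_atU U V c i : upset U -> upset V ->
    acyclic_at U c i -> acyclic_at V c i ->
    (forall j, i = j.+1 -> acyclic_at (fun m => U m && V m) c j) ->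
  acyclic_at (fun m => U m || V m) c i.
Proof.
move=> upU upV acU acV acI z supz dz.
pose zU A := if face U c i A then z A else 0; pose zV A := z A - zU A.
have supU A : zU A != 0 -> face U c i A.
  by rewrite /zU; case: ifP => //; rewrite eqxx.
have supV A : zV A != 0 -> face V c i A.
  rewrite /zV /zU; case: ifP => [_|nU]; first by rewrite subrr eqxx.
  rewrite subr0 => /supz /and3P[cA lA /orP[UA|VA]]; last by apply/and3P.
  by move: nU; rewrite /face cA lA UA.
have dV A : kdiff (fun=> 1) zV A = - kdiff (fun=> 1) zU A.
  by rewrite kdiffB dz sub0r.
have [w0 [w0U w0V] dw0] : exists2 w0,
    (forall A, w0 A != 0 -> face U c i A) /\
    (forall A, w0 A != 0 -> face V c i A) &
    forall A, kdiff (fun=> 1) w0 A = kdiff (fun=> 1) zU A.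
  (* Nothing lies below the empty face, so for [i = 0] both boundaries vanish and [w0 = 0]
     serves. *)
  case: i acI {acU acV supz dz} @zU @zV supU supV dV => [|i] acI zU zV supU supV dV.
    exists (fun=> 0); first by split=> A; rewrite eqxx.
    move=> A; rewrite !kdiff0 // => k kA; apply/eqP; apply: contraTT isT => /supU.
    by rewrite /face cardsU1 kA.
  have [|A|w0 sup0 d0] := acI _ (erefl _) (kdiff (fun=> 1) zU).
  - move=> A dA; have /and3P[cA lA UA] := kdiff_face upU supU dA.
    have : kdiff (fun=> 1) zV A != 0 by rewrite dV oppr_eq0.
    by move/(kdiff_face upV supV) => /and3P[_ _ VA]; apply/and4P.
  - exact: kdiff_kdiff.
  - exists w0 => //; split=> A /sup0 /and4P[cA lA UA VA]; exact/and3P.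
have nzB (x y : K) : x - y != 0 -> x != 0 \/ y != 0.
  case: (eqVneq x 0) => [->|]; last by left.
  by rewrite sub0r oppr_eq0; right.
have nzD (x y : K) : x + y != 0 -> x != 0 \/ y != 0.
  by rewrite -{1}(opprK y) => /nzB; rewrite oppr_eq0.
have [||wU supwU dwU] := acU (fun A => zU A - w0 A).
- by move=> A /nzB[/supU|/w0U].
- by move=> A; rewrite kdiffB dw0 subrr.
have [||wV supwV dwV] := acV (fun A => zV A + w0 A).
- by move=> A /nzD[/supV|/w0V].
- by move=> A; rewrite kdiffD dw0 dV addNr.
exists (fun A => wU A + wV A) => A.
  by move=> /nzD[/supwU|/supwV] /and3P[? ? h]; apply/and3P; rewrite h ?orbT.
by rewrite kdiffD dwU dwV /zV; ring.
Qed.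

End MultigradedChains.

(** * Regularity bounds from strands of the Koszul complex *)

Section RegularityBound.
Variables (K : fieldType) (n : nat).
Implicit Types (U V : 'X_{1..n} -> bool) (c m u : 'X_{1..n}) (i r : nat).

Notation var := (fun k : 'I_n => U_(k)%MM).

Lemma label_varE (A : {set 'I_n}) (k : 'I_n) : label var A k = (k \in A).
Proof.
rewrite /label mnm_sumE; under eq_bigr => j _ do rewrite mnm1E.
case: (boolP (k \in A)) => kA.
  rewrite (bigD1 k) //= eqxx big1 ?addn0 // => j /andP[_ /negbTE jk].
  by rewrite jk.
by rewrite big1 // => j jA; case: eqVneq kA => // <-; rewrite jA.
Qed.

Lemma mdeg_label_var (A : {set 'I_n}) : mdeg (label var A) = #|A|.
Proof.
by rewrite /label mdeg_sum (eq_bigr (fun=> 1%N)) ?sum1_card // => k _; rewrite mdeg1.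
Qed.

(* The strands of multidegree c of the Koszul complex of the variables with
   coefficients in the ideal of U compute Tor_i(K, I)_c. *)
Definition reg_le U r : Prop :=
  forall c i, (r + i < mdeg c)%N -> acyclic_at K var U c i.

Lemma eq_reg_le U V r : U =1 V -> reg_le U r -> reg_le V r.
Proof.
move=> e h c i lt; apply: eq_acyclic_at (h c i lt) => j A.
by rewrite /face e.
Qed.

Lemma reg_leW U r r' : (r <= r')%N -> reg_le U r -> reg_le U r'.
Proof. by move=> le h c i lt; apply: h; apply: leq_ltn_trans lt; rewrite leq_add2r. Qed.

Lemma reg_le0 r : reg_le (fun=> false) r.
Proof. by move=> c i _; apply: acyclic_at_noface => A; rewrite /face !andbF. Qed.

(** The intersection is used one homological degree lower, at [j] with [i = j.+1], where
    [r.+1 + j = r + i]. *)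
Lemma reg_leU U V r : upset U -> upset V -> reg_le U r -> reg_le V r ->
  reg_le (fun m => U m && V m) r.+1 -> reg_le (fun m => U m || V m) r.
Proof.
move=> upU upV rU rV rI c i lt; apply: acyclic_atU => //; [exact: rU|exact: rV|].
by move=> j ij; apply: rI; rewrite addSnnS -ij.
Qed.

Lemma lem_mdeg_eq m1 m2 : (m1 <= m2)%MM -> (mdeg m2 <= mdeg m1)%N -> m1 = m2.
Proof.
move=> le; rewrite -{1}(submK le) mdegD -{2}[mdeg m1]add0n leq_add2r leqn0 mdeg_eq0.
by move=> /eqP e; rewrite -(submK le) e add0m.
Qed.

Lemma reg_le_principal u : reg_le (fun m => (u <= m)%MM) (mdeg u).
Proof.
move=> c i lt; case: (boolP (u <= c)%MM) => [uc | nuc]; last first.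
  apply: acyclic_at_noface => A; apply: contra nuc => /and3P[_ lA].
  by move/lepm_trans; apply; rewrite lem_subr.
(* The faces are all sets of variables whose exponent in [c] exceeds that in [u]. For [i = 0] such a
   variable must exist: otherwise [c = u], against the degree assumption. *)
apply: (acyclic_at_simplex (D := [set k | (u k < c k)%N])); last first.
  case: i lt => //=; rewrite addn0 => lt; apply: contraTneq lt => /setP D0.
  rewrite -leqNgt (_ : c = u) //; apply/mnmP => k; apply/eqP.
  have := D0 k; rewrite !inE => /negbT; rewrite -leqNgt => ck.
  by rewrite eqn_leq ck (mnm_lepP uc).
move=> j A; rewrite /face; congr (_ && _); apply/andP/subsetP.
  move=> [/mnm_lepP lA /mnm_lepP uA] k kA; rewrite inE.
  by move: (lA k) (uA k); rewrite mnmBE label_varE kA /=; lia.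
move=> sub; split; apply/mnm_lepP => k; rewrite ?mnmBE label_varE;
  have := mnm_lepP uc k; case: (boolP (k \in A)) => [/sub|]; rewrite ?inE /=; lia.
Qed.

Lemma reg_le_shift U r u : reg_le U r ->
  reg_le (fun m => (u <= m)%MM && U (m - u)%MM) (mdeg u + r)%N.
Proof.
move=> rU c i lt; case: (boolP (u <= c)%MM) => [uc | nuc]; last first.
  apply: acyclic_at_noface => A; apply: contra nuc => /and4P[_ lA uA _].
  by apply: lepm_trans uA _; rewrite lem_subr.
apply: (eq_acyclic_at (U := U) (c := (c - u)%MM)); last first.
  by apply: rU; move: lt; rewrite -{1}(submK uc) mdegD; lia.
move=> j A; rewrite /face !submDA [(u + _)%MM]addmC; congr (_ && _).
rewrite andbA; congr (_ && _); apply/mnm_lepP/andP => [h|[/mnm_lepP h1 /mnm_lepP h2] k].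
  by split; apply/mnm_lepP => k; have := h k; have := mnm_lepP uc k; rewrite !mnmBE; lia.
by have := h1 k; have := h2 k; have := mnm_lepP uc k; rewrite !mnmBE; lia.
Qed.

End RegularityBound.

(** * Regularity of unions and intersections *)

Section RegularityOfUnions.
Variables (K : fieldType) (n : nat).
Implicit Types (U V : 'X_{1..n} -> bool) (m u E : 'X_{1..n}) (r : nat)
  (s : seq 'X_{1..n}).

Local Notation reg_le := (@reg_le K n).

Lemma upset_principal u : upset (fun m => (u <= m)%MM).
Proof. by move=> m m' mm' um; apply: lepm_trans mm'. Qed.

Lemma upsetI U V : upset U -> upset V -> upset (fun m => U m && V m).
Proof. by move=> uU uV m m' h /andP[/(uU _ _ h)-> /(uV _ _ h)->]. Qed.

Lemma upset_all (T : Type) (L : T -> 'X_{1..n} -> bool) (s : seq T) :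
  (forall x, upset (L x)) -> upset (fun m => all (L^~ m) s).
Proof. by move=> uL m m' h; apply: sub_all => x; apply: uL h. Qed.

Lemma upset_has (T : Type) (L : T -> 'X_{1..n} -> bool) (s : seq T) :
  (forall x, upset (L x)) -> upset (fun m => has (L^~ m) s).
Proof. by move=> uL m m' h; apply: sub_has => x; apply: uL h. Qed.

Lemma upset_shift u V : upset V -> upset (fun m => (u <= m)%MM && V (m - u)%MM).
Proof.
move=> uV m m' h /andP[um Vm]; rewrite (lepm_trans um h) /=; apply: uV Vm.
by apply/mnm_lepP => k; rewrite !mnmBE leq_sub2r // (mnm_lepP h).
Qed.

(** Iterated Mayer-Vietoris. Splitting off [x] replaces [V] by its intersection with [L x], hence
    the general [V], and each further member of [t] allows one more unit of regularity. *)
Lemma reg_le_has (T : eqType) V (L : T -> 'X_{1..n} -> bool) (s : seq T) r :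
    upset V -> (forall x, upset (L x)) ->
    (forall t, subseq t s -> t != [::] ->
      reg_le (fun m => V m && all (L^~ m) t) (r + (size t).-1)) ->
  reg_le (fun m => V m && has (L^~ m) s) r.
Proof.
elim: s V r => [|x s IHs] V r uV uL H.
  by apply: eq_reg_le (@reg_le0 _ _ _) => m; rewrite andbF.
apply: (eq_reg_le (U := fun m => (V m && L x m) || (V m && has (L^~ m) s))).
  by move=> m /=; rewrite andb_orr.
apply: reg_leU; [exact: upsetI | apply: upsetI => //; exact: upset_has | | |].
- have := H [:: x]; rewrite /= eqxx sub0seq addn0 => /(_ isT isT).
  by apply: eq_reg_le => m; rewrite andbT.
- apply: IHs => // t ts t0; apply: H => //.
  exact: subseq_trans ts (subseq_cons _ _).
apply: (eq_reg_le (U := fun m => (V m && L x m) && has (L^~ m) s)).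
  by move=> m; case: (V m); case: (L x m).
apply: IHs => // [|t ts t0]; first exact: upsetI.
have := H (x :: t); rewrite /= eqxx => /(_ ts isT) h.
case: t t0 ts h => //= y t _ _; rewrite addSnnS.
by apply: eq_reg_le => m; rewrite !andbA.
Qed.

Lemma mdeg_mlcm m1 m2 : (mdeg (mlcm m1 m2) <= mdeg m1 + mdeg m2)%N.
Proof. by rewrite mlcmE mdegD leq_add2l mdegB. Qed.

Definition mlcms (s : seq 'X_{1..n}) := foldr (@mlcm n) 0%MM s.

Lemma lem_mlcms s m : (mlcms s <= m)%MM = all (fun u => u <= m)%MM s.
Proof.
elim: s => [|u s IHs] /=; last by rewrite lem_mlcm IHs.
by apply/mnm_lepP => k; rewrite mnm0E.
Qed.

Lemma mdeg_mlcms s : (mdeg (mlcms s) <= sumn (map (@mdeg n) s))%N.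
Proof.
elim: s => [|u s IHs] /=; first by rewrite mdeg0.
by apply: leq_trans (mdeg_mlcm _ _) _; rewrite leq_add2l.
Qed.

(** The sum of [deg - 1] over the generators, plus 1; under [ci_degrees] the subtraction is not
    truncated. For the unit ideal, generated by 1 in degree 0, it gives 0. *)
Definition ci_reg (s : seq 'X_{1..n}) : nat :=
  ((sumn (map (@mdeg n) s)).+1 - size s)%N.

Definition ci_degrees (s : seq 'X_{1..n}) : Prop :=
  s = [:: 0%MM] \/ s != [::] /\ all (fun u => 0 < mdeg u)%N s.

(** Each generator of [s] left out of [t] has positive degree, so the degree sum minus the size can
    only grow from [t] to [s]. This bounds the degrees of lcms and products of generators, and also
    the shifts of the Koszul resolution. *)
Lemma ci_reg_subseq s (t : seq 'X_{1..n}) : ci_degrees s -> subseq t s -> t != [::] ->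
  (sumn (map (@mdeg n) t) <= ci_reg s + (size t).-1)%N.
Proof.
rewrite /ci_reg => -[-> | [_ pos]] ts t0.
  case: t t0 ts => // u [|v t] _ ts; last by have := size_subseq ts.
  by move: ts; rewrite sub1seq inE => /eqP ->; rewrite /= mdeg0.
suff : (sumn (map (@mdeg n) t) + size s <= sumn (map (@mdeg n) s) + size t)%N.
  by case: t t0 {ts} => //= *; lia.
elim: s t {t0} pos ts => [|u s IHs] [|v t] //= /andP[u0 pos].
  by move=> _; have := IHs [::] pos (sub0seq _) => /=; lia.
case: eqVneq => [-> ts|_ ts]; first by have := IHs t pos ts; lia.
by have := IHs (v :: t) pos ts => /=; lia.
Qed.

Lemma leq_size_sumn_mdeg s : all (fun u => 0 < mdeg u)%N s ->
  (size s <= sumn (map (@mdeg n) s))%N.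
Proof. by elim: s => //= u s IHs /andP[u0 /IHs]; lia. Qed.

Definition up (s : seq 'X_{1..n}) m : bool := has (fun u => u <= m)%MM s.

Lemma upset_up s : upset (up s).
Proof. by apply: upset_has => x; apply: upset_principal. Qed.

(** Two uses of [reg_le_has] leave principal ideals generated by lcms of nonempty subsequences,
    whose degrees are bounded by [ci_reg_subseq]. *)
Lemma reg_le_inter s t : ci_degrees s -> ci_degrees t ->
  reg_le (fun m => up s m && up t m) (ci_reg s + ci_reg t).
Proof.
move=> ds dt; apply: (eq_reg_le (U := fun m => up t m && up s m)).
  by move=> m; rewrite andbC.
have upr := upset_principal.
apply: reg_le_has; [exact: upset_up | exact: upr | move=> s' ss' s'0].
apply: (eq_reg_le (U := fun m => (mlcms s' <= m)%MM && up t m)).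
  by move=> m; rewrite lem_mlcms andbC.
apply: reg_le_has; [exact: upr | exact: upr | move=> t' tt' t'0].
apply: (eq_reg_le (U := fun m => mlcm (mlcms s') (mlcms t') <= m)%MM).
  by move=> m; rewrite lem_mlcm !lem_mlcms.
apply: reg_leW (@reg_le_principal _ _ _); apply: leq_trans (mdeg_mlcm _ _) _.
have := leq_trans (mdeg_mlcms s') (ci_reg_subseq ds ss' s'0).
have := leq_trans (mdeg_mlcms t') (ci_reg_subseq dt tt' t'0).
move=> ht hs; apply: leq_trans (leq_add hs ht) _.
by rewrite addnACA addnA; apply: leqnn.
Qed.

(** * Intersections of families of monomial ideals *)

Section Transversals.
Variables (I J : eqType).

(** Passing from [E'] to its lcm with [v i j] costs at most [w i j], so each [i] contributes like a
    complete intersection with degrees [w i j]. The hypothesis ranges over the multiples [E'] of [E]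
    because [E] grows during the induction. *)
Lemma reg_le_all_has (v : I -> J -> 'X_{1..n}) (w : I -> J -> nat) (l : seq I)
    (js : seq J) E :
    (forall i j E', (E <= E')%MM -> i \in l -> j \in js ->
      (0 < w i j)%N /\ (mdeg (mlcm E' (v i j)) <= mdeg E' + w i j)%N) ->
  reg_le (fun m => (E <= m)%MM && all (fun i => has (fun j => v i j <= m)%MM js) l)
    (mdeg E + \sum_(i <- l) (\sum_(j <- js) (w i j).-1).+1).
Proof.
have upr := upset_principal.
elim: l E => [|i l IHl] E H.
  rewrite big_nil addn0; apply: eq_reg_le (@reg_le_principal _ _ _) => m.
  by rewrite andbT.
rewrite big_cons; set A := \sum_(i <- l) _ in IHl *.
have {}IHl E' : (E <= E')%MM -> reg_le (fun m => (E' <= m)%MM &&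
    all (fun i => has (fun j => v i j <= m)%MM js) l) (mdeg E' + A).
  move=> EE'; apply: IHl => k j E2 E2' kl; apply: H; first exact: lepm_trans E2'.
  by rewrite inE kl orbT.
have {}H j E' : (E <= E')%MM -> j \in js ->
   (0 < w i j)%N /\ (mdeg (mlcm E' (v i j)) <= mdeg E' + w i j)%N.
  by move=> EE'; apply: H => //; rewrite inE eqxx.
pose L m := all (fun i => has (fun j => v i j <= m)%MM js) l.
have upL : upset L by apply: upset_all => k; apply: upset_has => j; apply: upr.
(* [js1] holds the generators of the [i]-th ideal still to be split off; [L] carries the conditions
   of the ideals after it. *)
suff gen js1 : {subset js1 <= js} -> forall E', (E <= E')%MM ->
    reg_le (fun m => (E' <= m)%MM && (has (fun j => v i j <= m)%MM js1 && L m))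
      (mdeg E' + ((\sum_(j <- js1) (w i j).-1).+1 + A)).
  by apply: (gen js) => //; apply: lepm_refl.
elim: js1 => [|j js1 IHjs] sub E' EE'.
  by apply: eq_reg_le (@reg_le0 _ _ _) => m; rewrite andbF.
have jjs : j \in js by apply: sub; apply: mem_head.
have {}sub : {subset js1 <= js} by move=> k kj; apply: sub; rewrite inE kj orbT.
have [wpos wle] := H j _ EE' jjs; rewrite big_cons.
apply: (eq_reg_le (U := fun m =>
   ((mlcm E' (v i j) <= m)%MM && L m) ||
   ((E' <= m)%MM && (has (fun j => v i j <= m)%MM js1 && L m)))).
  move=> m; rewrite lem_mlcm /=.
  by case: (E' <= m)%MM; case: (v i j <= m)%MM; case: (L m); case: has.
have EE2 : (E <= mlcm E' (v i j))%MM by apply: lepm_trans EE' (lem_mlcml _ _).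
apply: reg_leU; [exact: upsetI| | | |].
- by apply: upsetI => //; apply: upsetI => //; apply: upset_has => k; apply: upr.
- by apply: reg_leW (IHl _ EE2); lia.
- by apply: reg_leW (IHjs sub _ EE'); lia.
apply: (eq_reg_le (U := fun m => (mlcm E' (v i j) <= m)%MM &&
    (has (fun j => v i j <= m)%MM js1 && L m))).
  move=> m; rewrite lem_mlcm.
  by case: (E' <= m)%MM; case: (v i j <= m)%MM; case: (L m); case: has.
by apply: reg_leW (IHjs sub _ EE2); lia.
Qed.

Variables (e : J -> 'X_{1..n}) (c : I -> J -> 'X_{1..n}) (d : J -> nat).

(* T lists the indices split off so far, whose e j divide E.  Splitting off j
   separates the monomials divisible by e j from those captured by the other
   indices; the process stops at the principal ideal E as soon as every i has
   some j in T with c i j = 0. *)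
Lemma reg_le_transversal_aux (t : seq I) (js T : seq J) E i0 r :
    i0 \in t -> (forall j, j \in T -> c i0 j != 0%MM) ->
    (forall j, j \in T -> (e j <= E)%MM) ->
    (forall j, j \in js -> (0 < d j)%N /\
      (mdeg (e j) + \sum_(i <- t) mdeg (c i j) <= d j)%N) ->
    (mdeg E + \sum_(j <- T) \sum_(i <- t) mdeg (c i j)
       + \sum_(j <- js) (d j).-1 + 1 <= r + size T)%N ->
  reg_le (fun m => (E <= m)%MM &&
    all (fun i => has (fun j => e j + c i j <= m)%MM (T ++ js)) t) r.
Proof.
have upr := upset_principal.
elim: js T E i0 r => [|j js IHjs] T E i0 r i0t ci0 eE.
  move=> _; rewrite big_nil addn0 cats0 => ler.
  have [T0 | Tn0] := eqVneq T [::].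
    apply: eq_reg_le (@reg_le0 _ _ _) => m; rewrite T0.
    by case: t i0t {ler} => //= i t _; rewrite andbF.
  have T1 : (0 < size T)%N by case: T Tn0 {ci0 eE ler}.
  (* If [c i j = 0] for some [j] in [T], the condition at [i] follows from [e j <= E]. For the
     indices kept in [l], reaching [e j + c i j] from a multiple of [E] costs at most the degree of
     [c i j]. *)
  pose l := [seq i <- t | all (fun j => c i j != 0%MM) T].
  apply: (eq_reg_le (U := fun m => (E <= m)%MM &&
      all (fun i => has (fun j => e j + c i j <= m)%MM T) l)).
    move=> m; case: (boolP (E <= m)%MM) => //= Em; rewrite /l all_filter.
    apply: eq_in_all => i it; case: (boolP (all (fun j => c i j != 0%MM) T)) => h.
      by rewrite /= h.
    rewrite /= (negbTE h); move: h; rewrite -has_predC.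
    move=> /hasP[j jT /negbNE/eqP cij].
    by symmetry; apply/hasP; exists j => //; rewrite cij addm0; apply: lepm_trans (eE _ jT) Em.
  apply: reg_leW (reg_le_all_has (w := fun i j => mdeg (c i j)) _); last first.
    move=> i j E' EE'; rewrite mem_filter => /andP[/allP h it] jT; split.
      by rewrite lt0n mdeg_eq0 h.
    rewrite mlcmE mdegD leq_add2l !mdegE leq_sum // => k _; rewrite mnmBE mnmDE.
    by have := mnm_lepP (eE _ jT) k; have := mnm_lepP EE' k; lia.
  have i0l : i0 \in l by rewrite mem_filter i0t andbT; apply/allP.
  (* All [c i j] with [i] in [l] have positive degree, so lowering each by 1 saves [size T]. As [i0]
     is in [l], this is saved at least once, which accounts for [size T] in the hypothesis on
     [r]. *)
  have X i : i \in l -> ((\sum_(j <- T) (mdeg (c i j)).-1).+1 + (size T).-1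
      = \sum_(j <- T) mdeg (c i j))%N.
    rewrite mem_filter => /andP[h _].
    suff : (\sum_(j <- T) (mdeg (c i j)).-1 + size T
       = \sum_(j <- T) mdeg (c i j))%N by lia.
    elim: (T) h => [|k s IHs] /=; first by rewrite !big_nil.
    by rewrite !big_cons -mdeg_eq0 => /andP[ck /IHs]; lia.
  have X1 : (\sum_(i <- l) (\sum_(j <- T) (mdeg (c i j)).-1).+1 + (size T).-1
     <= \sum_(i <- l) \sum_(j <- T) mdeg (c i j))%N.
    rewrite !(big_rem _ i0l) /= -(X _ i0l) addnAC leq_add2l.
    by rewrite !big_seq leq_sum // => i /mem_rem /X <-; rewrite leq_addr.
  have X2 : (\sum_(i <- l) \sum_(j <- T) mdeg (c i j)
      <= \sum_(j <- T) \sum_(i <- t) mdeg (c i j))%N.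
    rewrite (exchange_big_idem _ _ (op := addn)) //=; apply: leq_sum => j _.
    by rewrite big_filter [X in (_ <= X)%N](bigID (fun i => all (fun j => c i j != 0%MM) T)) leq_addr.
  by move: ler X1 X2 T1; lia.
move=> bd ler.
have [dj0 dj] := bd j (mem_head _ _).
have {}bd k : k \in js -> (0 < d k)%N /\
    (mdeg (e k) + \sum_(i <- t) mdeg (c i k) <= d k)%N.
  by move=> kj; apply: bd; rewrite inE kj orbT.
move: ler; rewrite big_cons => ler.
set E2 := mlcm E (e j).
have EE2 : (E <= E2)%MM by apply: lem_mlcml.
have dE2 := mdeg_mlcm E (e j); rewrite -/E2 in dE2.
pose L T m := all (fun i => has (fun j => e j + c i j <= m)%MM T) t.
have upL T2 : upset (L T2).
  by apply: upset_all => k; apply: upset_has => k'; apply: upr.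
(* In the first part [j] joins [T]. The second part drops [j], which loses nothing at monomials not
   divisible by [e j], since these are not divisible by any [e j + c i j]. *)
apply: (eq_reg_le (U := fun m => ((E2 <= m)%MM && L ((j :: T) ++ js) m) ||
    ((E <= m)%MM && L (T ++ js) m))).
  move=> m; rewrite lem_mlcm; case: (boolP (E <= m)%MM) => //= Em.
  have -> : L ((j :: T) ++ js) m = L (T ++ j :: js) m.
    by apply: eq_all => i; rewrite !has_cat /= orbCA !orbA.
  case: (boolP (e j <= m)%MM) => /= ejm.
    case: (boolP (L (T ++ js) m)) => [h|_]; last by rewrite orbF.
    rewrite orbT; symmetry; apply: sub_all h => i; rewrite !has_cat /=.
    by case: has => //= ->; rewrite orbT.
  apply: eq_all => i; rewrite !has_cat /=; congr (_ || _).
  have /negbTE -> // : ~~ (e j + c i j <= m)%MM.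
  apply: contra ejm; apply: lepm_trans; exact: lem_addr.
have T1 k : k \in j :: T -> (e k <= E2)%MM.
  rewrite inE => /orP[/eqP ->|/eE h]; first exact: lem_mlcmr.
  exact: lepm_trans h EE2.
apply: reg_leU; [exact: upsetI | exact: upsetI | | |].
(* The recursion needs a new witness [i1], nonzero on all of [j :: T]. If there is none, every
   condition follows from divisibility by [E2] and the ideal is principal. *)
- case: (boolP (has (fun i => all (fun k => c i k != 0%MM) (j :: T)) t)).
    move=> /hasP[i1 i1t /allP h1]; apply: (IHjs _ _ i1) => //=.
    by rewrite big_cons; lia.
  rewrite -all_predC => /allP h.
  apply: (eq_reg_le (U := fun m => (E2 <= m)%MM)).
    move=> m; case: (boolP (E2 <= m)%MM) => //= E2m; symmetry; apply/allP => i it.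
    have : ~~ all (fun k => c i k != 0%MM) (j :: T) := h _ it.
    rewrite -has_predC => /hasP[k kT /negbNE/eqP cik].
    apply/hasP; exists k; first by rewrite -cat_cons mem_cat kT.
    by rewrite cik addm0; apply: lepm_trans (T1 _ kT) E2m.
  apply: reg_leW (@reg_le_principal _ _ _).
  suff : (size T <= \sum_(k <- T) \sum_(i <- t) mdeg (c i k))%N by lia.
  rewrite -sum1_size !big_seq; apply: leq_sum => k /ci0 ck.
  rewrite (big_rem _ i0t) /= -[1%N]addn0 leq_add // lt0n mdeg_eq0 //.
- by apply: (IHjs _ _ i0) => //; lia.
apply: (eq_reg_le (U := fun m => (E2 <= m)%MM && L (T ++ js) m)).
  move=> m; case: (boolP (L (T ++ js) m)) => [h|_]; last by rewrite !andbF.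
  rewrite (_ : L (_ ++ _) m); last first.
    by apply: sub_all h => i /=; rewrite orbC => ->.
  by rewrite !andbT /E2 lem_mlcm andbAC andbb.
apply: (IHjs _ _ i0) => // [k /eE h|]; first exact: lepm_trans h EE2.
by lia.
Qed.

(** The splitting starts with [T] empty and [E = 0], the monomial 1. The bound is that of a complete
    intersection with degrees [d j]. *)
Lemma reg_le_transversal (t : seq I) (js : seq J) :
    t != [::] ->
    (forall j, j \in js -> (0 < d j)%N /\
      (mdeg (e j) + \sum_(i <- t) mdeg (c i j) <= d j)%N) ->
  reg_le (fun m => all (fun i => has (fun j => e j + c i j <= m)%MM js) t)
    ((\sum_(j <- js) d j).+1 - size js)%N.
Proof.
case: t => // i0 t _ bd.
apply: (eq_reg_le (U := fun m => (0 <= m)%MM &&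
    all (fun i => has (fun j => e j + c i j <= m)%MM ([::] ++ js)) (i0 :: t))).
  by move=> m; rewrite (_ : (0 <= m)%MM) //; apply/mnm_lepP => k; rewrite mnm0E.
apply: (@reg_le_transversal_aux _ _ _ _ i0) => //; first exact: mem_head.
rewrite mdeg0 big_nil !add0n addn0.
suff : (\sum_(j <- js) (d j).-1 + size js = \sum_(j <- js) d j)%N by lia.
rewrite -sum1_size -big_split /= !big_seq; apply: eq_bigr => j /bd[]; lia.
Qed.

End Transversals.
End RegularityOfUnions.

(** * Regularity of products *)

Section RegularityOfProducts.
Variables (K : fieldType) (n : nat).
Implicit Types (u v m : 'X_{1..n}) (s t : seq 'X_{1..n}).

Definition mcoprime u v : bool := [forall k : 'I_n, (u k == 0%N) || (v k == 0%N)].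

Lemma lem_coprimeD u v m : mcoprime u v ->
  (u + v <= m)%MM = (u <= m)%MM && (v <= m)%MM.
Proof.
move=> /forallP cop; apply/idP/andP => [h|[/mnm_lepP um /mnm_lepP vm]].
  by split; apply: lepm_trans h; rewrite ?lem_addr ?lem_addl.
apply/mnm_lepP => k; rewrite mnmDE.
by have := cop k; have := um k; have := vm k; lia.
Qed.

Lemma mcoprime_sum u t : all (mcoprime u) t -> mcoprime u (\sum_(v <- t) v)%MM.
Proof.
move=> /allP cop; apply/forallP => k; rewrite mnm_sumE.
case: eqVneq => //= uk; apply/eqP; rewrite big_seq big1 // => v /cop /forallP.
by move=> /(_ k); rewrite (negbTE uk) => /eqP.
Qed.

Lemma lem_sum_coprime t m : pairwise mcoprime t ->
  (\sum_(u <- t) u <= m)%MM = all (fun u => u <= m)%MM t.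
Proof.
elim: t => [_|u t IHt] /=.
  by rewrite big_nil; apply/mnm_lepP => k; rewrite mnm0E.
by move=> /andP[cu ct]; rewrite big_cons lem_coprimeD ?IHt // mcoprime_sum.
Qed.

(* The function [minn x] is concave, so its marginal increments decrease. *)
Lemma sum_marginal_min (a : seq nat) x :
  (\sum_(y <- a) ((x - (sumn a - y)) - (x - sumn a)) <= minn x (sumn a))%N.
Proof.
elim: a => [|b a IHa]; first by rewrite big_nil.
rewrite big_cons /=.
suff : (\sum_(y <- a) (x - (b + sumn a - y) - (x - (b + sumn a)))
  <= \sum_(y <- a) (x - (sumn a - y) - (x - sumn a)))%N by lia.
rewrite !big_seq; apply: leq_sum => y ya.
suff : (y <= sumn a)%N by lia.
by rewrite sumnE (big_rem _ ya) leq_addr.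
Qed.

Definition up_prod s t m : bool :=
  has (fun u => has (fun v => u + v <= m)%MM t) s.

(** In each variable this is [sum_marginal_min]. For pairwise coprime [t] with product [F], the
    monomials on the left are [v / gcd(v, F)] and the [gcd(v, u)]. *)
Lemma leq_mdeg_marginal t v :
  (mdeg (v - \sum_(w <- t) w)
    + \sum_(u <- t) mdeg ((v - (\sum_(w <- t) w - u)) - (v - \sum_(w <- t) w))
   <= mdeg v)%N.
Proof.
rewrite (eq_bigr _ (fun u _ => mdegE _)) [mdeg (v - _)]mdegE.
rewrite exchange_big /= -big_split mdegE /=; apply: leq_sum => k _.
rewrite mnmBE mnm_sumE.
have -> : \sum_(w <- t) w k = sumn [seq (w : 'X_{1..n}) k | w <- t].
  by rewrite sumnE big_map.
under eq_bigr => u _ do rewrite !mnmBE mnm_sumE.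
have := sum_marginal_min [seq (w : 'X_{1..n}) k | w <- t] (v k).
by rewrite big_map sumnE big_map /=; lia.
Qed.

Lemma reg_le_prod s t : pairwise mcoprime s ->
  ci_degrees s -> ci_degrees t ->
  reg_le K (up_prod s t) (ci_reg s + ci_reg t).
Proof.
(* If the second ideal is the unit ideal, the product equals the intersection. *)
move=> cop ds dt; case: (dt) => [t0 | [tn0 tpos]].
  apply: eq_reg_le (@reg_le_inter K n s t ds dt) => m; rewrite /up_prod t0 /up /=.
  have -> : (0 <= m)%MM by apply/mnm_lepP => k; rewrite mnm0E.
  by rewrite andbT; apply: eq_has => u /=; rewrite addm0 orbF.
have upr := @upset_principal n.
apply: (@eq_reg_le K n (fun m => true &&
    has (fun u => (u <= m)%MM && up t (m - u)%MM) s) _ (ci_reg s + ci_reg t)).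
  move=> m; apply: eq_has => u; rewrite /up andbC; apply/andP/hasP.
    move=> [/hasP[v vt vm] um]; exists v => //.
    by rewrite -(submK um) addmC; apply/mnm_lepP => k; rewrite !mnmDE leq_add2r (mnm_lepP vm).
  move=> [v vt uvm]; split; last by apply: lepm_trans uvm; rewrite lem_addr.
  apply/hasP; exists v => //; apply/mnm_lepP => k.
  by have := mnm_lepP uvm k; rewrite mnmDE mnmBE; lia.
apply: (reg_le_has (L := fun u m => (u <= m)%MM && up t (m - u)%MM)) => //.
  by move=> u; apply: upset_shift; apply: upset_up.
move=> s' ss' s'0.
have cop' : pairwise mcoprime s' := subseq_pairwise ss' cop.
pose F := (\sum_(u <- s') u)%MM.
have Fle u : u \in s' -> (u <= F)%MM.
  by move=> us; rewrite /F (big_rem _ us) lem_addr.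
(* For [m] divisible by [F], [u + v <= m] means [v - (F - u) <= m - F]. The left side is written as
   [v - F], independent of [u], plus a remainder. *)
apply: (eq_reg_le (U := fun m => (F <= m)%MM && all (fun u =>
    has (fun v => (v - F) + ((v - (F - u)) - (v - F)) <= m - F)%MM t) s')).
  move=> m; rewrite /F lem_sum_coprime // -/F.
  case: (boolP (all (fun u => u <= m)%MM s')) => /= [h|]; last first.
    rewrite -has_predC => /hasP[u us num]; symmetry; apply/negbTE.
    by rewrite -has_predC; apply/hasP; exists u => //=; rewrite (negbTE num).
  apply: eq_in_all => u us; rewrite (allP h u us); apply: eq_has => v /=.
  have Fm : (F <= m)%MM by rewrite lem_sum_coprime.
  have e k := (mnm_lepP (Fle _ us) k, mnm_lepP Fm k).
  apply/mnm_lepP/mnm_lepP => lev k; have := lev k; have [] := e k;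
  rewrite ?mnmDE ?mnmBE; lia.
apply: reg_leW (reg_le_shift (reg_le_transversal (K := K)
  (e := fun v => (v - F)%MM) (c := fun u v => (v - (F - u) - (v - F))%MM)
  (d := @mdeg n) s'0 _)).
  have : (mdeg F <= ci_reg s + (size s').-1)%N.
    rewrite /F mdeg_sum; have := ci_reg_subseq ds ss' s'0.
    by rewrite sumnE big_map.
  by move=> h; rewrite addnAC; apply: leq_add h _; rewrite /ci_reg sumnE big_map.
move=> v vt; split; first exact: (allP tpos).
exact: leq_mdeg_marginal.
Qed.

End RegularityOfProducts.

(** * Koszul complexes of monomials *)

Section MonomialKoszul.
Variables (K : fieldType) (n N : nat) (f : 'I_N -> 'X_{1..n}).
Implicit Types (U : 'X_{1..n} -> bool) (c m : 'X_{1..n}) (i : nat)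
  (z w : {set 'I_N} -> {mpoly K[n]}) (A : {set 'I_N}).

Lemma mcoeffXM (p : {mpoly K[n]}) u m :
  ('X_[u] * p)@_m = if (u <= m)%MM then p@_(m - u) else 0.
Proof.
rewrite mulrC; case: ifP => um.
  by rewrite -{1}(submK um) [(_ + u)%MM]addmC mcoeffMX.
apply: contraFeq um; rewrite -mcoeff_msupp (perm_mem (msuppMX _ _)).
by move=> /mapP[m' _ ->]; rewrite lem_addr.
Qed.

Definition strand c z A : K :=
  if (label f A <= c)%MM then (z A)@_(c - label f A) else 0.

Lemma strandE z A m : strand (m + label f A) z A = (z A)@_m.
Proof. by rewrite /strand lem_addl addmK. Qed.

Definition monomials k : {mpoly K[n]} := 'X_[f k].

(** Multiplication by ['X_[f k]] makes up for the change of label from [k |: A] to [A], so in a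
    fixed multidegree the Koszul boundary is the simplicial one over the field. *)
Lemma strand_kdiff c z A :
  strand c (kdiff monomials z) A = kdiff (fun=> 1) (strand c z) A.
Proof.
rewrite {1}/strand; case: ifP => lA; last first.
  rewrite kdiff0 // => k kA; rewrite /strand labelU1 //.
  case: ifP => // /(lepm_trans (lem_addl _ _)) h.
  by rewrite h in lA.
rewrite /kdiff raddf_sum; apply: eq_bigr => k kA /=.
rewrite /ksign -[in LHS]signr_odd -[in RHS]signr_odd mulr1 -mulrA !mulr_sign.
have -> : strand c z (k |: A) = ('X_[f k] * z (k |: A))@_(c - label f A).
  rewrite mcoeffXM /strand labelU1 //.
  have -> : (f k + label f A <= c)%MM = (f k <= c - label f A)%MM.
    apply/mnm_lepP/mnm_lepP => h j; have := h j; have := mnm_lepP lA j;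
      rewrite mnmDE mnmBE; lia.
  by case: ifP => // _; rewrite submDA addmC.
by case: odd; rewrite ?mcoeffN.
Qed.

Lemma kdiff_monomials_exact U i z :
    (forall A m, (z A)@_m != 0 -> (#|A| == i) && U m) ->
    (forall A, kdiff monomials z A = 0) ->
    (forall c A, strand c z A != 0 -> acyclic_at K f U c i) ->
  exists2 w, (forall A m, (w A)@_m != 0 -> (#|A| == i.+1) && U m) &
    forall A, kdiff monomials w A = z A.
Proof.
move=> supz dz acU.
(* The multidegrees occurring in [z]. The equation is solved over the field in each of them, and
   since they are finitely many the solutions add up to polynomials. *)
pose C := undup (flatten [seq [seq (m + label f A)%MM | m <- msupp (z A)] |
  A <- enum {set 'I_N}]).
have inC A m : (z A)@_m != 0 -> (m + label f A)%MM \in C.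
  rewrite -mcoeff_msupp mem_undup => mz; apply/flatten_mapP; exists A.
    by rewrite mem_enum.
  exact: map_f.
have outC c A : c \notin C -> strand c z A = 0.
  rewrite /strand; case: ifP => // lA; apply: contraNeq => /inC.
  by rewrite submK.
have /choice[W HW] : forall c, exists Wc : {set 'I_N} -> K, c \in C ->
    (forall A, Wc A != 0 -> face f U c i.+1 A) /\
    (forall A, kdiff (fun=> 1) Wc A = strand c z A).
  move=> c; case: (boolP (c \in C)) => [cC|_]; last by exists (fun=> 0).
  have ac : acyclic_at K f U c i.
    move: cC; rewrite mem_undup => /flatten_mapP[A _ /mapP[m mz ->]].
    by apply: (acU _ A); rewrite strandE -mcoeff_msupp.
  have [||w supw dw] := ac (strand c z); last by exists w.
  - move=> A; rewrite /strand /face; case: ifP => [_ /supz//|]; by rewrite eqxx.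
  - move=> A; rewrite -strand_kdiff /strand dz mcoeff0; by case: ifP.
pose w A := \sum_(c <- C | (label f A <= c)%MM) W c A *: 'X_[c - label f A].
have wE A m : (w A)@_m =
    if (m + label f A)%MM \in C then W (m + label f A)%MM A else 0.
  rewrite /w raddf_sum /=.
  have term c : (label f A <= c)%MM ->
      (W c A *: 'X_[c - label f A])@_m = W c A * (c == m + label f A)%MM%:R.
    move=> lA; rewrite mcoeffZ mcoeffX -(eqm_add2r (label f A)) submK //.
  rewrite (eq_bigr _ term); case: ifP => mC.
    rewrite (big_rem _ mC) /= lem_addl eqxx mulr1 big_seq_cond big1 ?addr0 // => c.
    rewrite (mem_rem_uniq _ (undup_uniq _)) => /andP[/andP[/= /negbTE -> _] _].
    exact: mulr0.
  rewrite big_seq_cond big1 // => c /andP[cC _]; case: eqVneq => [e|_].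
    by rewrite -e cC in mC.
  exact: mulr0.
have strandw c A : c \in C -> strand c w A = W c A.
  move=> cC; rewrite /strand; case: ifP => lA; first by rewrite wE submK // cC.
  by symmetry; apply: contraFeq lA => /(HW c cC).1 /and3P[].
exists w => A => [m|].
  rewrite wE; case: ifP => [mC|]; last by rewrite eqxx.
  by move=> /(HW _ mC).1 /and3P[-> _]; rewrite addmK.
apply/mpolyP => m; rewrite -!strandE strand_kdiff.
case: (boolP ((m + label f A)%MM \in C)) => [mC | nC].
  rewrite -(HW _ mC).2; apply: eq_bigr => k _; by rewrite strandw.
rewrite outC // kdiff0 // => k kA; rewrite /strand; case: ifP => // l.
by rewrite wE submK // (negbTE nC).
Qed.

End MonomialKoszul.

(** * The Koszul complex of the variables *)

Section VariableKoszul.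
Variables (K : fieldType) (n : nat).
Implicit Types (U : 'X_{1..n} -> bool) (c m : 'X_{1..n}) (i r : nat)
  (z w : {set 'I_n} -> {mpoly K[n]}) (A : {set 'I_n}).

Notation var := (fun k : 'I_n => U_(k)%MM).
Notation kdX := (kdiff (monomials K var)).

(** In multidegree [c] the strand is the full simplex on the variables dividing [c], which is empty
    only for [c = 0]; hence the condition on the constant term when [i = 0]. *)
Lemma kdiff_var_exact i z :
    (forall A, z A != 0 -> #|A| == i) ->
    (forall A, kdX z A = 0) -> (i = 0%N -> (z (finset.set0))@_0 = 0) ->
  exists2 w, (forall A, w A != 0 -> #|A| == i.+1) & forall A, kdX w A = z A.
Proof.
move=> supz dz z0.
have [||| w supw dw] := @kdiff_monomials_exact K n n var (fun=> true) i z.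
- move=> A m zA; rewrite andbT; apply: supz; apply: contraNneq zA => ->.
  by rewrite mcoeff0.
- exact: dz.
- move=> c A nz; apply: (acyclic_at_simplex (D := [set k | (0 < c k)%N])).
    move=> j B; rewrite /face andbT; congr (_ && _).
    apply/mnm_lepP/subsetP => [h k kB|h k].
      by rewrite inE; have := h k; rewrite label_varE kB.
    by rewrite label_varE; case: (boolP (k \in B)) => // /h; rewrite inE.
  case: i supz z0 => //= supz z0; apply: contraNneq nz => /setP D0.
  have -> : c = 0%MM.
    by apply/mnmP => k; rewrite mnm0E; have := D0 k; rewrite !inE; case: (c k).
  rewrite /strand; case: ifP => // _; rewrite sub0m.
  case: (eqVneq (z A) 0) => [->|/supz]; first by rewrite mcoeff0.
  by rewrite cards_eq0 => /eqP ->; rewrite z0.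
exists w => // A wA; suff [m /supw] : exists m, (w A)@_m != 0 by rewrite andbT.
have : msupp (w A) != [::] by rewrite msupp_eq0.
case E: (msupp (w A)) => [//|m s] _; exists m.
by rewrite -mcoeff_msupp E mem_head.
Qed.

Lemma mcoeff0_kdX z A : (kdX z A)@_0 = 0.
Proof.
rewrite raddf_sum big1 // => k _ /=; rewrite -mulrA mulrCA mcoeffXM.
by rewrite lep1mP mnm0E.
Qed.

End VariableKoszul.

(** * Homogeneous components of Koszul chains *)

Section HomogeneousParts.
Variables (K : fieldType) (n : nat).
Implicit Types (p q : {mpoly K[n]}) (d e : int).

(** Degrees are integers because they arise as differences of shifts; in negative degrees the part
    is 0. *)
Definition hpart e p : {mpoly K[n]} :=
  \sum_(m <- msupp p | (mdeg m)%:Z == e) p@_m *: 'X_[m].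

Lemma mcoeff_hpart e p m : (hpart e p)@_m = if (mdeg m)%:Z == e then p@_m else 0.
Proof.
have term m' : (p@_m' *: 'X_[m'])@_m = if m' == m then p@_m else 0.
  by rewrite mcoeffZ mcoeffX; case: eqVneq => [->|]; rewrite ?mulr1 ?mulr0.
rewrite /hpart raddf_sum (eq_bigr _ (fun m' _ => term m')) /= -big_mkcondr /=.
case: (eqVneq p@_m 0) => [-> | pm]; first by rewrite big1 // if_same.
rewrite -mcoeff_msupp in pm; rewrite (big_rem _ pm) /= eqxx andbT.
rewrite big_seq_cond big1 ?addr0 // => m'; rewrite (mem_rem_uniq _ (msupp_uniq _)).
by case/and3P => /andP[/= /negbTE ->].
Qed.

Lemma hpart0 e : hpart e 0 = 0.
Proof. by apply/mpolyP => m; rewrite mcoeff_hpart mcoeff0 if_same. Qed.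

Lemma hpart_sum (I : Type) (r : seq I) (P : pred I) (G : I -> {mpoly K[n]}) e :
  hpart e (\sum_(i <- r | P i) G i) = \sum_(i <- r | P i) hpart e (G i).
Proof.
apply/mpolyP => m; rewrite mcoeff_hpart !(raddf_sum (mcoeff m)) /=.
rewrite (eq_bigr _ (fun i _ => mcoeff_hpart e (G i) m)).
by case: (_ == e) => //; rewrite big1.
Qed.

Definition homogeneous e p : Prop := forall m, p@_m != 0 -> (mdeg m)%:Z = e.

Lemma homog_homogeneous e p : homog_of_degree e p -> homogeneous e p.
Proof.
move=> [-> m | [d -> /dhomogP h] m]; first by rewrite mcoeff0 eqxx.
by rewrite -mcoeff_msupp => /h ->.
Qed.

Lemma hpartM d e p q : homogeneous d q ->
  hpart (e + d) (p * q) = hpart e p * q.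
Proof.
move=> hq; rewrite {1}[q]mpolyE [in RHS](mpolyE q) !mulr_sumr hpart_sum.
rewrite !big_seq; apply: eq_bigr => m; rewrite mcoeff_msupp => /hq dm.
apply/mpolyP => m'; rewrite -!scalerAr mcoeff_hpart !mcoeffZ -!(mulrC 'X_[m]).
rewrite !mcoeffXM; case: (boolP (m <= m')%MM) => [mm'|_]; last by rewrite mulr0 if_same.
rewrite mcoeff_hpart -(submK mm') mdegD addmK PoszD dm (inj_eq (addIr _)).
by case: ifP; rewrite ?mulr0.
Qed.

End HomogeneousParts.

(** * Koszul chains with values in graded free modules *)

Section KoszulRows.
Variables (K : fieldType) (n : nat).
Implicit Types (A B : {set 'I_n}) (d : int).
Notation S := {mpoly K[n]}.
Notation kdX := (kdiff (monomials K (fun k : 'I_n => U_(k)%MM))).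

Definition kdrow r (z : {set 'I_n} -> 'rV[S]_r) A : 'rV[S]_r :=
  \row_j kdX (fun B => z B 0 j) A.

Lemma eq_kdrow r (z z' : {set 'I_n} -> 'rV[S]_r) A :
  (forall k, k \notin A -> z (k |: A) = z' (k |: A)) -> kdrow z A = kdrow z' A.
Proof. by move=> e; apply/rowP => j; rewrite !mxE; apply: eq_kdiff => k /e ->. Qed.

Lemma kdrow0 r (z : {set 'I_n} -> 'rV[S]_r) A :
  (forall k, k \notin A -> z (k |: A) = 0) -> kdrow z A = 0.
Proof.
by move=> e; apply/rowP => j; rewrite !mxE kdiff0 // => k /e ->; rewrite mxE.
Qed.

Lemma kdrow_supp r (z : {set 'I_n} -> 'rV[S]_r) i A :
  (forall B, z B != 0 -> #|B| == i) -> #|A|.+1 != i -> kdrow z A = 0.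
Proof.
move=> supz Ai; apply: kdrow0 => k kA; apply: contraNeq Ai => /supz.
by rewrite cardsU1 kA.
Qed.

Lemma kdrowB r (z z' : {set 'I_n} -> 'rV[S]_r) A :
  kdrow (fun B => z B - z' B) A = kdrow z A - kdrow z' A.
Proof.
apply/rowP => j; rewrite !mxE -kdiffB; apply: eq_kdiff => k _.
by rewrite !mxE.
Qed.

Lemma kdrowD r (z z' : {set 'I_n} -> 'rV[S]_r) A :
  kdrow (fun B => z B + z' B) A = kdrow z A + kdrow z' A.
Proof.
apply/rowP => j; rewrite !mxE -kdiffD; apply: eq_kdiff => k _.
by rewrite !mxE.
Qed.

Lemma kdrow_kdrow r (z : {set 'I_n} -> 'rV[S]_r) A : kdrow (kdrow z) A = 0.
Proof.
apply/rowP => j; rewrite !mxE -[RHS](kdiff_kdiff (monomials K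
  (fun k : 'I_n => U_(k)%MM)) (fun B => z B 0 j) A).
by apply: eq_kdiff => k _; rewrite mxE.
Qed.

Lemma kdrow_mulmx r r' (z : {set 'I_n} -> 'rV[S]_r) (D : 'M[S]_(r, r')) A :
  kdrow (fun B => z B *m D) A = kdrow z A *m D.
Proof.
apply/rowP => j; rewrite !mxE.
rewrite (@eq_kdiff _ _ _ _ (fun B => \sum_l z B 0 l * D l j)); last first.
  by move=> k _; rewrite mxE.
by rewrite kdiff_sum; apply: eq_bigr => l _; rewrite mxE.
Qed.

Lemma kdrow_exact r i (z : {set 'I_n} -> 'rV[S]_r) :
    (forall A, z A != 0 -> #|A| == i) -> (forall A, kdrow z A = 0) ->
    (i = 0%N -> forall j, (z finset.set0 0 j)@_0 = 0) ->
  exists2 w : {set 'I_n} -> 'rV[S]_r,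
    (forall A, w A != 0 -> #|A| == i.+1) & forall A, kdrow w A = z A.
Proof.
move=> supz dz z0.
have /choice[W HW] : forall j : 'I_r, exists W : {set 'I_n} -> S,
    (forall A, W A != 0 -> #|A| == i.+1) /\ forall A, kdX W A = z A 0 j.
  move=> j; have [||| w supw dw] := @kdiff_var_exact K n i (fun A => z A 0 j).
  - by move=> A zA; apply: supz; apply: contraNneq zA => ->; rewrite mxE eqxx.
  - by move=> A; have /rowP/(_ j) := dz A; rewrite !mxE.
  - by move=> /z0.
  - by exists w.
exists (fun A => \row_j W j A) => A.
  apply: contraR => Ai; apply/eqP/rowP => j; rewrite !mxE; apply/eqP.
  by apply: contraNT Ai => /(HW j).1.
apply/rowP => j; rewrite mxE -(HW j).2; apply: eq_kdiff => k _.
by rewrite mxE.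
Qed.

Definition rowpart r (s : 'I_r -> int) d (v : 'rV[S]_r) : 'rV[S]_r :=
  \row_j hpart (d - s j) (v 0 j).

Lemma rowpart0 r (s : 'I_r -> int) d : rowpart s d 0 = 0.
Proof. by apply/rowP => j; rewrite !mxE hpart0. Qed.

Lemma rowpart_mulmx r r' (s : 'I_r -> int) (s' : 'I_r' -> int) d
    (v : 'rV[S]_r) (D : 'M[S]_(r, r')) :
    (forall j k, homog_of_degree (s j - s' k) (D j k)) ->
  rowpart s' d (v *m D) = rowpart s d v *m D.
Proof.
move=> hD; apply/rowP => k; rewrite !mxE hpart_sum; apply: eq_bigr => j _.
rewrite mxE -(hpartM _ _ (homog_homogeneous (hD j k))); congr (hpart _ _).
by rewrite addrA subrK.
Qed.

Lemma hpart_idem d (p : S) : hpart d (hpart d p) = hpart d p.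
Proof. by apply/mpolyP => m; rewrite !mcoeff_hpart; case: (_ == d). Qed.

Lemma rowpart_idem r (s : 'I_r -> int) d v :
  rowpart s d (rowpart s d v) = rowpart s d v.
Proof. by apply/rowP => j; rewrite !mxE hpart_idem. Qed.

(** The basis element at [A] has degree [#|A|], so the Koszul boundary preserves the total degree
    [d]. *)
Lemma hpart_kdX d z A :
  hpart (d - #|A|%:Z) (kdX z A) = kdX (fun B => hpart (d - #|B|%:Z) (z B)) A.
Proof.
rewrite hpart_sum; apply: eq_bigr => k kA.
rewrite mulrC [RHS]mulrC -(hpartM (d := 1)).
  by congr (hpart _ _); rewrite cardsU1 kA PoszD /=; ring.
move=> m; rewrite /ksign -signr_odd mulr_sign.
suff h : ('X_[K, U_(k)])@_m != 0 -> (mdeg m)%:Z = 1.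
  by case: odd => //; rewrite mcoeffN oppr_eq0.
by rewrite mcoeffX; case: (eqVneq U_(k)%MM m) => [<-|]; rewrite ?mdeg1 ?eqxx.
Qed.

Lemma rowpart_kdrow r (s : 'I_r -> int) d z A :
  rowpart s (d - #|A|%:Z) (kdrow z A) =
  kdrow (fun B => rowpart s (d - #|B|%:Z) (z B)) A.
Proof.
apply/rowP => j; rewrite !mxE addrAC hpart_kdX; apply: eq_kdiff => k _.
by rewrite mxE addrAC.
Qed.

Lemma kdrow_graded_lift r (s : 'I_r -> int) d (y z : {set 'I_n} -> 'rV[S]_r) :
    (forall A, kdrow y A = z A) ->
    (forall A, rowpart s (d - #|A|%:Z) (z A) = z A) ->
  forall A, kdrow (fun B => rowpart s (d - #|B|%:Z) (y B)) A = z A.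
Proof. by move=> dy gz A; rewrite -rowpart_kdrow dy gz. Qed.

End KoszulRows.

(** * Betti numbers and Koszul homology *)

Section TorByKoszul.
Variables (K : fieldType) (n : nat).
Notation S := {mpoly K[n]}.
Implicit Types (A B : {set 'I_n}) (d : int) (I : set S) (F : free_complex K n).
Notation kdX := (kdiff (monomials K (fun k : 'I_n => U_(k)%MM))).

(* Vanishing in degree d of the i-th Koszul homology of I. *)
Definition koszul_vanishes I i d : Prop :=
  forall z : {set 'I_n} -> S, (forall A, I (z A)) ->
    (forall A, z A != 0 -> #|A| == i) ->
    (forall A, hpart (d - #|A|%:Z) (z A) = z A) ->
    (forall A, kdX z A = 0) ->
  exists2 w, (forall A, I (w A)) & forall A, kdX w A = z A.

Section Resolution.
Variables (F : free_complex K n) (I : set S).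
Hypotheses (grF : graded_complex F) (resF : resolves F I).

Lemma aug_kdX (w : {set 'I_n} -> 'rV[S]_(fr_rank F 0)) A :
  kdX (fun B => (w B *m fr_aug F) 0 0) A = (kdrow w A *m fr_aug F) 0 0.
Proof. by rewrite -kdrow_mulmx mxE. Qed.

Lemma hpart_aug d v :
  hpart d ((v *m fr_aug F) 0 0) = (rowpart (@fr_shift K n F 0) d v *m fr_aug F) 0 0.
Proof.
rewrite -(rowpart_mulmx (s' := fun=> 0)) ?mxE ?subr0 // => j k.
by rewrite subr0 ord1; apply: grF.1.
Qed.

Lemma rowpart_diff i d v :
  rowpart (@fr_shift K n F i) d (v *m fr_diff F i) =
  rowpart (@fr_shift K n F i.+1) d v *m fr_diff F i.
Proof. by apply: rowpart_mulmx => j k; apply: grF.2. Qed.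

Lemma aug_eq0 (v : 'rV[S]_(fr_rank F 0)) :
  (v *m fr_aug F) 0 0 = 0 -> exists w, v = w *m fr_diff F 0.
Proof.
by case: resF => _ ex0 _ h; apply/ex0/matrixP => i j; rewrite !ord1 h mxE.
Qed.

Lemma diff_aug (v : 'rV[S]_(fr_rank F 1)) : v *m fr_diff F 0 *m fr_aug F = 0.
Proof. by case: resF => _ ex0 _; apply/ex0; exists v. Qed.

Lemma diff_diff i (v : 'rV[S]_(fr_rank F i.+2)) : v *m fr_diff F i.+1 *m fr_diff F i = 0.
Proof. by case: resF => _ _ ex; apply/ex; exists v. Qed.

Lemma diff_eq0 i (v : 'rV[S]_(fr_rank F i.+1)) :
  v *m fr_diff F i = 0 -> exists w, v = w *m fr_diff F i.+1.
Proof. by case: resF => _ _ ex /ex. Qed.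

Section Chase.
Variable d : int.

(* A zigzag in the double complex F tensor Koszul complex, from F_p tensor
   Lambda^q down to I tensor Lambda^(p+q). *)
Lemma chase_up p q (y : {set 'I_n} -> 'rV[S]_(fr_rank F p)) :
    minimal_complex F -> koszul_vanishes I (p + q)%N d ->
    (forall A, y A != 0 -> #|A| == q) ->
    (forall A, rowpart (@fr_shift K n F p) (d - #|A|%:Z) (y A) = y A) ->
    (exists y'', forall A, kdrow y A = y'' A *m fr_diff F p) ->
  exists w v, forall A, y A = kdrow w A + v A *m fr_diff F p.
Proof.
move=> minF; elim: p q y => [|p IHp] q y KV supy gry [y'' dy].
  (* The augmentation of [y] is a Koszul cycle of [I]. Once a filling of it is lifted to [F_0],
     subtracting the boundary of the lift from [y] lands in the kernel of the augmentation. *)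
  have [||||w0 Iw0 dw0] := KV (fun A => (y A *m fr_aug F) 0 0).
  - by move=> A; case: resF => -> _ _; exists (y A).
  - move=> A zA; apply: supy; apply: contraNneq zA => ->.
    by rewrite mul0mx mxE eqxx.
  - by move=> A; rewrite hpart_aug gry.
  - by move=> A; rewrite aug_kdX dy diff_aug mxE.
  have /choice[w wE] : forall A, exists v : 'rV_(fr_rank F 0), (v *m fr_aug F) 0 0 = w0 A.
    by move=> A; case: resF => <- _ _.
  have /choice[v vE] : forall A, exists v : 'rV_(fr_rank F 1), y A - kdrow w A = v *m fr_diff F 0.
    move=> A; apply: aug_eq0; rewrite mulmxBl mxE [in X in _ + X]mxE -aug_kdX -dw0.
    by apply/eqP; rewrite subr_eq0; apply/eqP/eq_kdiff => k _; rewrite wE.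
  by exists w, v => A; rewrite -vE addrC subrK.
(* By minimality the entries of [z] have no constant term, so [z] is a Koszul boundary even when
   [q = 0]. *)
pose z A := y A *m fr_diff F p.
have supz A : z A != 0 -> #|A| == q.
  by move=> zA; apply: supy; apply: contraNneq zA => yA; rewrite /z yA mul0mx.
have grz A : rowpart (@fr_shift K n F p) (d - #|A|%:Z) (z A) = z A.
  by rewrite rowpart_diff gry.
have [||y0 supy0 dy0] := kdrow_exact supz.
- by move=> A; rewrite kdrow_mulmx dy diff_diff.
- move=> _ j; rewrite mxE (raddf_sum (mcoeff 0%MM)) big1 // => k _.
  by rewrite /= (rmorphM (mcoeff 0%MM)) /= minF mulr0.
pose y1 A := rowpart (@fr_shift K n F p) (d - #|A|%:Z) (y0 A).
have dy1 A : kdrow y1 A = z A by apply: kdrow_graded_lift.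
have [||||w [v wv]] := IHp q.+1 y1.
- by rewrite addnS.
- by move=> A h; apply: supy0; apply: contraNneq h => yA; rewrite /y1 yA rowpart0.
- by move=> A; apply: rowpart_idem.
- by exists y.
have /choice[v' v'E] : forall A, exists v' : 'rV_(fr_rank F p.+2), y A - kdrow v A = v' *m fr_diff F p.+1.
  move=> A; apply: diff_eq0; rewrite mulmxBl -/(z A) -dy1 -kdrow_mulmx.
  rewrite (eq_kdrow (z' := fun B => kdrow w B + v B *m fr_diff F p)); last first.
    by move=> k _; rewrite wv.
  by rewrite kdrowD kdrow_kdrow add0r subrr.
by exists v, v' => A; rewrite -v'E addrC subrK.
Qed.

(* The reverse zigzag, up to F_(p+q) tensor Lambda^0. *)
Lemma chase_down p q (y : {set 'I_n} -> 'rV[S]_(fr_rank F p)) :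
    (forall j : 'I_(fr_rank F (p + q)%N), fr_shift j <> d) ->
    (forall A, y A != 0 -> #|A| == q) ->
    (forall A, rowpart (@fr_shift K n F p) (d - #|A|%:Z) (y A) = y A) ->
    (exists y'', forall A, kdrow y A = y'' A *m fr_diff F p) ->
  exists w v, forall A, y A = kdrow w A + v A *m fr_diff F p.
Proof.
elim: q p y => [|q IHq] p y nogen supy gry [y'' dy].
  (* For [q = 0], a nonzero constant term in coordinate [j] would force the shift of [j] to be [d],
     which is excluded. *)
  have [||w _ dw] := kdrow_exact supy.
  - by move=> A; rewrite (kdrow_supp supy).
  - move=> _ j; have /rowP/(_ j) := gry finset.set0; rewrite mxE cards0 subr0 => <-.
    rewrite mcoeff_hpart mdeg0; case: eqP => // e.
    move: nogen; rewrite addn0 => /(_ j); case.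
    by apply/eqP; rewrite eq_sym -subr_eq0 -e.
  by exists w, (fun=> 0) => A; rewrite mul0mx addr0 dw.
(* Cutting [y''] down to cardinality [q] and total degree [d] keeps its image [kdrow y], which is
   already concentrated there. *)
pose y2 A := if #|A| == q then
  rowpart (@fr_shift K n F p.+1) (d - #|A|%:Z) (y'' A) else 0.
have y2E A : y2 A *m fr_diff F p = kdrow y A.
  rewrite /y2; case: eqP => Aq; last first.
    by rewrite mul0mx (kdrow_supp (i := q.+1)) // eqSS; apply/eqP.
  by rewrite -rowpart_diff -dy rowpart_kdrow; apply: eq_kdrow => k _; rewrite gry.
have [||||w [v wv]] := IHq p.+1 y2.
- by rewrite addSnnS.
- by move=> A; rewrite /y2; case: ifP => //; rewrite eqxx.
- by move=> A; rewrite /y2; case: ifP => _; rewrite ?rowpart0 ?rowpart_idem.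
- suff /choice[y3 h] : forall A, exists v : 'rV_(fr_rank F p.+2),
    kdrow y2 A = v *m fr_diff F p.+1 by exists y3.
  move=> A; apply: diff_eq0; rewrite -kdrow_mulmx.
  rewrite (eq_kdrow (z' := kdrow y)) ?kdrow_kdrow // => k _; exact: y2E.
(* With [w] cut down to cardinality [q.+1], [y] minus the image of [w1] is a Koszul cycle in
   positive cardinality, hence a boundary. *)
pose w1 A := if #|A| == q.+1 then w A else 0.
have dw1 A : kdrow w1 A *m fr_diff F p = kdrow y A.
  rewrite -y2E; case: (eqVneq #|A| q) => Aq.
    rewrite wv mulmxDl diff_diff addr0; congr (_ *m _).
    by apply: eq_kdrow => k kA; rewrite /w1 cardsU1 kA Aq eqxx.
  rewrite /y2 (negbTE Aq) (kdrow_supp (i := q.+1)) //.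
  by move=> B; rewrite /w1; case: ifP => //; rewrite eqxx.
have [|||w2 _ dw2] := @kdrow_exact _ _ _ q.+1 (fun A => y A - w1 A *m fr_diff F p).
- move=> A; apply: contraR => Aq; rewrite /w1 (negbTE Aq) mul0mx subr0.
  by apply/eqP; apply: contraNeq Aq => /supy.
- by move=> A; rewrite kdrowB kdrow_mulmx dw1 subrr.
- by [].
by exists w2, w1 => A; rewrite dw2 subrK.
Qed.

End Chase.

(** Otherwise [chase_up] would write the basis element [j] as a Koszul boundary plus an element of
    the image of [F_(i+1)]. Both have zero constant terms, the latter by minimality, while the basis
    element has constant term 1. *)
Lemma koszul_vanishes_shift i (j : 'I_(fr_rank F i)) :
  minimal_complex F -> ~ koszul_vanishes I i (fr_shift j).
Proof.
move=> minF KV.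
pose y A : 'rV[S]_(fr_rank F i) := if #|A| == 0%N then delta_mx 0 j else 0.
have [||||w [v wv]] := @chase_up (fr_shift j) i 0 y minF.
- by rewrite addn0.
- by move=> A; rewrite /y; case: ifP => //; rewrite eqxx.
- move=> A; rewrite /y; case: eqP => [-> | _]; last exact: rowpart0.
  apply/rowP => k; rewrite !mxE eqxx /=; case: eqVneq => [->|_]; last exact: hpart0.
  apply/mpolyP => m; rewrite mcoeff_hpart mcoeff1 !subr0 subrr.
  by case: (eqVneq m 0%MM) => [->|_]; rewrite ?mdeg0 ?if_same.
- exists (fun=> 0) => A; rewrite mul0mx kdrow0 // => k kA.
  by rewrite /y cardsU1 kA.
have := wv finset.set0; rewrite /y cards0 eqxx => /rowP/(_ j).
move/(congr1 (mcoeff 0)); rewrite !mxE !eqxx mcoeff1 eqxx mcoeffD mcoeff0_kdX add0r.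
rewrite (raddf_sum (mcoeff 0%MM)) big1 => [/eqP|k _]; first by rewrite oner_eq0.
by rewrite /= (rmorphM (mcoeff 0%MM)) /= minF mulr0.
Qed.

(** A cycle of [I] is lifted to [F_0], and [chase_down] then shows that it is a boundary modulo the
    kernel of the augmentation. *)
Lemma koszul_vanishes_nogen i d :
  (forall j : 'I_(fr_rank F i), fr_shift j <> d) -> koszul_vanishes I i d.
Proof.
move=> nogen z Iz supz grz dz.
have /choice[y0 y0E] : forall A, exists v : 'rV_(fr_rank F 0), (v *m fr_aug F) 0 0 = z A.
  by move=> A; case: resF => <- _ _; apply: Iz.
pose y A := if #|A| == i then
  rowpart (@fr_shift K n F 0) (d - #|A|%:Z) (y0 A) else 0.
have yE A : (y A *m fr_aug F) 0 0 = z A.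
  rewrite /y; case: ifP => [_|]; first by rewrite -hpart_aug y0E grz.
  by move=> Ai; rewrite mul0mx mxE; symmetry; apply: contraFeq Ai => /supz.
have [||||w [v wv]] := @chase_down d 0 i y.
- exact: nogen.
- by move=> A; rewrite /y; case: ifP => //; rewrite eqxx.
- by move=> A; rewrite /y; case: ifP => _; rewrite ?rowpart0 ?rowpart_idem.
- suff /choice[y3 h] : forall A, exists v : 'rV_(fr_rank F 1),
    kdrow y A = v *m fr_diff F 0 by exists y3.
  move=> A; apply: aug_eq0; rewrite -aug_kdX -(dz A).
  by apply: eq_kdiff => k _.
exists (fun A => (w A *m fr_aug F) 0 0) => A.
  by case: resF => -> _ _; exists (w A).
by rewrite aug_kdX -yE wv mulmxDl diff_aug addr0.
Qed.

End Resolution.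
End TorByKoszul.

(** * The Koszul resolution *)

Section RegularityComparison.
Variables (K : fieldType) (n : nat).
Implicit Types (I : set {mpoly K[n]}) (U : 'X_{1..n} -> bool).

Definition is_monomial_ideal U I : Prop :=
  forall p, I p <-> forall m, p@_m != 0 -> U m.

(** A generator of [F] attaining [r] gives nonzero Koszul homology, which forces a generator of [F']
    with the same shift and homological degree. This yields the uniqueness of the regularity. *)
Lemma is_regularity_le I (r r' : int) :
  is_regularity I r -> is_regularity I r' -> r <= r'.
Proof.
move=> [F [[grF resF minF] [i [j ->]] _]] [F' [[grF' resF' _] _ bd]].
rewrite leNgt; apply/negP => lt.
apply: (koszul_vanishes_shift grF resF (j := j) minF).
apply: (koszul_vanishes_nogen grF' resF') => k e.
by move: lt; rewrite ltNge -e bd.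
Qed.

Lemma reg_eq I (r : int) : is_regularity I r -> reg I = r.
Proof.
move=> h; have h' : is_regularity I (reg I) by apply: (xgetPex 0 (ex_intro _ _ h)).
by apply/eqP; rewrite eq_le !(@is_regularity_le I).
Qed.

Lemma reg_le_koszul_vanishes U I r i (d : int) : is_monomial_ideal U I ->
  reg_le K U r -> (r + i)%N%:Z < d -> koszul_vanishes I i d.
Proof.
move=> IU rU lt z Iz supz grz dz.
have [||| w supw dw] := @kdiff_monomials_exact K n n
    (fun k => U_(k)%MM) U i z.
- move=> A m zA; apply/andP; split; last by apply/(IU (z A)): m zA.
  by apply: supz; apply: contraNneq zA => ->; rewrite mcoeff0.
- exact: dz.
(* A chain of total degree [d] has nonzero strands only in multidegrees [c] with [mdeg c = d], which
   exceeds [r + i]. *)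
- move=> c A; rewrite /strand; case: ifP => lA; last by rewrite eqxx.
  move=> zA; apply: rU; rewrite -ltz_nat; apply: lt_le_trans lt _.
  have Ai : #|A| == i by apply: supz; apply: contraNneq zA => ->; rewrite mcoeff0.
  move: zA; rewrite -grz mcoeff_hpart; case: ifP => [/eqP|]; last by rewrite eqxx.
  move=> e _; have := mdegD (c - label (fun k => U_(k)%MM) A) (label (fun k => U_(k)%MM) A).
  by rewrite submK // mdeg_label_var => ->; rewrite PoszD e subrK.
exists w => // A; apply/IU => m /supw /andP[//].
Qed.

Lemma reg_le_reg U I r : is_monomial_ideal U I -> reg_le K U r ->
  reg I <= r%:Z.
Proof.
(* If no regularity exists, [reg I] is the default value 0 and the bound is trivial. *)
move=> IU rU; rewrite /reg; case: xgetP => [r' -> [F [[grF resF minF] [i [j ->]] _]]|//].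
rewrite leNgt; apply/negP => lt.
apply: (koszul_vanishes_shift grF resF (j := j) minF).
by apply: (reg_le_koszul_vanishes IU rU); rewrite PoszD -ltrBrDr.
Qed.

End RegularityComparison.

(** * The Koszul resolution of pairwise coprime monomials *)

Section KoszulResolution.
Variables (K : fieldType) (n N : nat) (f : 'I_N -> 'X_{1..n}).
Notation S := {mpoly K[n]}.
Implicit Types (A B : {set 'I_N}) (i : nat).
Notation kdf := (kdiff (monomials K f)).

(** Subsets have [i.+1] elements because the ideal is resolved rather than the quotient: [F_0] is
    indexed by the generators. *)
Definition cells i : {set {set 'I_N}} := [set A : {set 'I_N} | #|A| == i.+1].

Definition incidence A B : S :=
  \sum_(l | (l \notin B) && (l |: B == A)) ksign _ l B * monomials K f l.

Lemma cells_bounded i : (N < i)%N -> #|cells i| = 0%N.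
Proof.
move=> Ni; apply: eq_card0 => A; rewrite inE; apply: contraTF Ni => /eqP e.
by rewrite -leqNgt ltnW // -e -[X in (_ <= X)%N]card_ord max_card.
Qed.

Definition koszul_complex : free_complex K n :=
  @FreeComplex K n N (fun i => #|cells i|)
    (fun i j => (mdeg (label f (enum_val j)))%:Z)
    (fun i => \matrix_(j, k) incidence (enum_val j) (enum_val k))
    (\col_k incidence (enum_val k) finset.set0)
    cells_bounded.

(** Turns rows indexed by [cells i] into functions on all subsets, so that the matrices act as
    [kdiff]. *)
Definition chain i (v : 'rV[S]_#|cells i|) A : S :=
  \sum_(j | enum_val j == A) v 0 j.

Lemma chain_supp i (v : 'rV[S]_#|cells i|) A : chain v A != 0 -> #|A| == i.+1.
Proof.
apply: contraR => Ai; rewrite /chain big1 // => j /eqP e.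
by move: Ai; rewrite -e; have := enum_valP j; rewrite inE => ->.
Qed.

Lemma chain_enum_val i (v : 'rV[S]_#|cells i|) j : chain v (enum_val j) = v 0 j.
Proof.
by rewrite /chain (eq_bigl (pred1 j)) ?big_pred1_eq // => k; rewrite (inj_eq enum_val_inj).
Qed.

Lemma sum_incidence i (v : 'rV[S]_#|cells i|) B :
  \sum_j v 0 j * incidence (enum_val j) B = kdf (chain v) B.
Proof.
rewrite /kdiff /chain /incidence.
under eq_bigr => j _ do rewrite mulr_sumr.
rewrite (exchange_big_dep (fun l => l \notin B)) /=; last by move=> j l _ /andP[].
apply: eq_bigr => l lB; rewrite mulr_sumr lB /=.
by apply: eq_big => j; [rewrite eq_sym | rewrite mulrC].
Qed.

Lemma koszul_diffE i (v : 'rV[S]_(fr_rank koszul_complex i.+1)) k :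
  (v *m fr_diff koszul_complex i) 0 k = kdf (chain v) (enum_val k).
Proof.
by rewrite mxE -sum_incidence; apply: eq_bigr => j _; rewrite mxE.
Qed.

Lemma koszul_augE (v : 'rV[S]_(fr_rank koszul_complex 0)) :
  (v *m fr_aug koszul_complex) 0 0 = kdf (chain v) finset.set0.
Proof.
by rewrite mxE -sum_incidence; apply: eq_bigr => j _; rewrite mxE.
Qed.

Lemma kdiff_chain i (v : 'rV[S]_#|cells i.+1|) B :
  #|B| != i.+1 -> kdf (chain v) B = 0.
Proof.
move=> Bi; rewrite kdiff0 // => k kB; apply: contraNeq Bi => /chain_supp.
by rewrite cardsU1 kB.
Qed.

Lemma chain_koszul_diff i (v : 'rV[S]_(fr_rank koszul_complex i.+1)) B :
  chain (v *m fr_diff koszul_complex i) B = kdf (chain v) B.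
Proof.
case: (boolP (B \in cells i)) => Bi.
  by rewrite -[B](enum_rankK_in Bi Bi) chain_enum_val koszul_diffE.
rewrite inE in Bi; rewrite kdiff_chain //.
by apply: contraNeq Bi => /chain_supp.
Qed.

Lemma chain_row i (z : {set 'I_N} -> S) A : (z A != 0 -> #|A| == i.+1) ->
  chain (\row_(j < #|cells i|) z (enum_val j)) A = z A.
Proof.
move=> supz; case: (boolP (A \in cells i)) => Ai.
  by rewrite -[A](enum_rankK_in Ai Ai) chain_enum_val mxE.
transitivity (0 : S); first by apply: contraNeq Ai; rewrite inE => /chain_supp.
by symmetry; apply: contraNeq Ai; rewrite inE.
Qed.

Hypothesis f_coprime : forall k l, k != l -> mcoprime (f k) (f l).

(** A product of coprime monomials is their lcm, so every strand is a full simplex on the generators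
    dividing [c]. *)
Lemma label_coprime A c :
  (label f A <= c)%MM = (A \subset [set k | (f k <= c)%MM]).
Proof.
have -> : label f A = (\sum_(u <- [seq f k | k <- enum A]) u)%MM.
  by rewrite big_map big_enum.
rewrite lem_sum_coprime.
  rewrite all_map; apply/allP/subsetP => h k kA.
    by rewrite inE; apply: h; rewrite mem_enum.
  by have := h k; rewrite inE; apply; rewrite mem_enum in kA.
have := enum_uniq A; rewrite uniq_pairwise pairwise_map; apply: sub_pairwise.
by move=> k l; apply: f_coprime.
Qed.

Lemma kdiff_coprime_exact i (z : {set 'I_N} -> S) :
    (forall A, z A != 0 -> #|A| == i.+1) -> (forall A, kdf z A = 0) ->
  exists2 w, (forall A, w A != 0 -> #|A| == i.+2) & forall A, kdf w A = z A.
Proof.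
move=> supz dz.
have [||| w supw dw] := @kdiff_monomials_exact K n N f (fun=> true) i.+1 z.
- move=> A m zA; rewrite andbT; apply: supz; apply: contraNneq zA => ->.
  by rewrite mcoeff0.
- exact: dz.
- move=> c A _; apply: (acyclic_at_simplex (D := [set k | (f k <= c)%MM])) => //.
  by move=> j B; rewrite /face andbT label_coprime.
exists w => // A wA; suff [m /supw] : exists m, (w A)@_m != 0 by rewrite andbT.
have : msupp (w A) != [::] by rewrite msupp_eq0.
case E: (msupp (w A)) => [//|m s] _; exists m.
by rewrite -mcoeff_msupp E mem_head.
Qed.

Lemma koszul_complex_resolves U I : is_monomial_ideal U I ->
  (forall m, U m = [exists k, (f k <= m)%MM]) -> resolves koszul_complex I.
Proof.
move=> IU Uf; split.
- move=> p; split=> [/IU pU | [v <-]]; last first.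
    apply/IU => m; rewrite koszul_augE (raddf_sum (mcoeff m)) Uf /=.
    apply: contraR; rewrite negb_exists => /forallP nf; apply/eqP/big1 => k _.
    by rewrite -mulrA mulrCA mcoeffXM (negbTE (nf k)).
  (* [p] is viewed as a chain on the empty set; each of its monomials is divisible by some [f k], so
     the relevant simplices are nonempty. *)
  have [||| w supw dw] := @kdiff_monomials_exact K n N f (fun=> true) 0
      (fun A => if A == finset.set0 then p else 0).
  + move=> A m; rewrite cards_eq0; case: ifP => //; by rewrite mcoeff0 eqxx.
  + move=> A; rewrite kdiff0 // => k kA; rewrite -cards_eq0 cardsU1 kA.
    by [].
  + move=> c A; rewrite /strand; case: (eqVneq A finset.set0) => [->|_]; last first.
      by rewrite mcoeff0 if_same eqxx.
    rewrite /label big_set0 subm0; case: ifP => _; last by rewrite eqxx.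
    move=> /pU; rewrite Uf => /existsP[k kc].
    apply: (acyclic_at_simplex (D := [set k | (f k <= c)%MM])).
      by move=> j B; rewrite /face andbT label_coprime.
    by apply/set0Pn; exists k; rewrite inE.
  exists (\row_(j < #|cells 0|) w (enum_val j)).
  rewrite koszul_augE -[RHS](_ : (if finset.set0 == finset.set0 :> {set 'I_N} then p else 0) = p).
    rewrite -dw; apply: eq_kdiff => k _; apply: chain_row => wk.
    have : msupp (w (k |: finset.set0)) != [::] by rewrite msupp_eq0.
    case E: (msupp _) => [//|m s] _; have := supw (k |: finset.set0) m.
    by rewrite -mcoeff_msupp E mem_head andbT; apply.
  by rewrite eqxx.
- move=> v; split=> [v0 | [w ->]]; last first.
    apply/matrixP => a b; rewrite !ord1 koszul_augE [RHS]mxE.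
    by rewrite -[RHS](kdiff_kdiff (monomials K f) (chain w) finset.set0);
      apply: eq_kdiff => k _; rewrite chain_koszul_diff.
  have [||w supw dw] := @kdiff_coprime_exact 0 (chain v).
  + exact: chain_supp.
  + move=> A; case: (eqVneq A finset.set0) => [->|A0].
      by rewrite -koszul_augE v0 mxE.
    rewrite kdiff0 // => k kA; apply: contraNeq A0 => /chain_supp.
    by rewrite cardsU1 kA eqSS cards_eq0.
  exists (\row_(j < #|cells 1|) w (enum_val j)); apply/rowP => k.
  rewrite koszul_diffE -chain_enum_val -dw; apply: eq_kdiff => l _.
  by rewrite chain_row //; apply: supw.
move=> i v; split=> [v0 | [w ->]]; last first.
  apply/rowP => k; rewrite koszul_diffE [RHS]mxE.
  by rewrite -[RHS](kdiff_kdiff (monomials K f) (chain w) (enum_val k));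
    apply: eq_kdiff => l _; rewrite chain_koszul_diff.
have [||w supw dw] := @kdiff_coprime_exact i.+1 (chain v).
- exact: chain_supp.
- move=> A; rewrite -chain_koszul_diff v0.
  by rewrite /chain big1 // => j _; rewrite mxE.
exists (\row_(j < #|cells i.+2|) w (enum_val j)); apply/rowP => k.
rewrite koszul_diffE -chain_enum_val -dw; apply: eq_kdiff => l _.
by rewrite chain_row //; apply: supw.
Qed.

Lemma incidenceE A B : incidence A B = 0 \/
  exists l, [/\ l \notin B, l |: B = A & incidence A B = ksign _ l B * 'X_[f l]].
Proof.
case: (pickP (fun l => (l \notin B) && (l |: B == A))) => [l /andP[lB lA]|none].
  right; exists l; split=> //; first exact/eqP.
  rewrite /incidence (bigD1 l) ?lB //= big1 ?addr0 // => k /andP[/andP[kB kA] kl].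
  have : k \in l |: B by rewrite (eqP lA) -(eqP kA) setU11.
  by rewrite !inE (negbTE kl) (negbTE kB).
by left; rewrite /incidence big_pred0.
Qed.

Lemma incidence_homog A B :
  homog_of_degree ((mdeg (label f A))%:Z - (mdeg (label f B))%:Z) (incidence A B).
Proof.
case: (incidenceE A B) => [-> | [l [lB <- ->]]]; [by left | right].
exists (mdeg (f l)); first by rewrite labelU1 // mdegD PoszD addrK.
by rewrite /ksign -signr_odd mulr_sign; case: odd; rewrite ?rpredN dhomogX eqxx.
Qed.

Lemma koszul_complex_graded : graded_complex koszul_complex.
Proof.
split=> [k | i j k]; rewrite mxE; last exact: incidence_homog.
have := incidence_homog (enum_val k) finset.set0.
by rewrite {2}/label big_set0 mdeg0 subr0.
Qed.

(** The alternative [N <= 1] covers the unit ideal, whose generator has degree 0: then [F_1] is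
    already zero. *)
Lemma koszul_complex_minimal :
  (N <= 1)%N \/ (forall k, 0 < mdeg (f k))%N -> minimal_complex koszul_complex.
Proof.
move=> fpos i j k; rewrite mxE.
case: (incidenceE (enum_val j) (enum_val k)) => [-> | [l [_ _ ->]]].
  exact: mcoeff0.
case: fpos => [N1 | /(_ l) fl].
  have := enum_valP j; rewrite inE => /eqP e.
  have := max_card (enum_val j); rewrite card_ord => le.
  by have := leq_trans le N1; rewrite e.
rewrite mulrC mcoeffXM; case: ifP => // le; move: fl.
by rewrite (lem_mdeg_eq le) ?mdeg0.
Qed.

End KoszulResolution.

(** * Monomial complete intersections *)

Section CompleteIntersections.
Variables (K : fieldType) (n : nat).
Implicit Types (s t : seq 'X_{1..n}) (I J : set {mpoly K[n]}) (m u : 'X_{1..n}).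

Lemma reg_coprime s I : pairwise (@mcoprime n) s -> ci_degrees s ->
  is_monomial_ideal (up s) I -> reg I = (ci_reg s)%:Z.
Proof.
move=> cop ds Is; pose f := tnth (in_tuple s); pose N := size s.
have s_f : s = [seq f k | k <- enum 'I_N] by rewrite map_tnth_enum.
have fcop k l : k != l -> mcoprime (f k) (f l).
  have /(pairwiseP 0%MM) copP := cop.
  wlog kl : k l / (k < l)%N => [hw kl|_].
    move: (kl); rewrite -val_eqE neq_ltn => /orP[lt|lt]; first exact: hw.
    have : mcoprime (f l) (f k) by apply: hw => //; rewrite eq_sym.
    by rewrite /mcoprime; under eq_forallb => j do rewrite orbC.
  by rewrite /f !(tnth_nth 0%MM); apply: copP; rewrite ?inE ?ltn_ord.
have N0 : (0 < N)%N.
  by rewrite lt0n size_eq0; case: ds => [-> | []].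
have fpos : (N <= 1)%N \/ (forall k, 0 < mdeg (f k))%N.
  case: ds => [s0 | [_ /allP pos]]; [left | right => k].
    by rewrite /N s0.
  exact: (pos _ (mem_tnth k (in_tuple s))).
apply: reg_eq; exists (koszul_complex K f); split.
- split; [exact: koszul_complex_graded | | exact: koszul_complex_minimal].
  apply: koszul_complex_resolves Is _ => // m; rewrite /up {1}s_f has_map.
  apply/hasP/existsP => [[k _ km] | [k km]]; exists k => //.
  by rewrite mem_enum.
(* The maximum is attained by the set of all generators, in homological degree [N.-1]. *)
- have TN : [set: 'I_N] \in cells N N.-1 by rewrite inE cardsT card_ord prednK.
  exists N.-1, (enum_rank_in TN [set: 'I_N]).
  rewrite /= enum_rankK_in // /label (eq_bigl xpredT) => [|k]; last exact: in_setT.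
  rewrite mdeg_sum.
  rewrite /ci_reg -/N.
  have -> : (\sum_k mdeg (f k))%N = sumn (map (@mdeg n) s).
    by rewrite [in RHS]s_f sumnE 2!big_map big_enum.
  have : (N <= (sumn (map (@mdeg n) s)).+1)%N.
    case: (ds) => [s0 | [_ pos]]; first by rewrite /N s0.
    by apply: leqW; exact: (leq_size_sumn_mdeg pos).
  by move: N0; lia.
move=> i j; rewrite /=.
have := enum_valP j; rewrite inE => /eqP Ai.
set A := enum_val j in Ai *.
have sub : subseq [seq f k | k <- enum A] s.
  by rewrite [X in subseq _ X]s_f enumT; apply: map_subseq; apply: filter_subseq.
have A0 : [seq f k | k <- enum A] != [::].
  by rewrite -size_eq0 size_map -cardE Ai.
have := ci_reg_subseq ds sub A0.
rewrite size_map -cardE Ai /= sumnE 2!big_map big_enum /=.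
by move=> le; rewrite lerBlDr -PoszD lez_nat mdeg_sum.
Qed.

Lemma mcoeffM_supp (p q : {mpoly K[n]}) m : (p * q)@_m != 0 ->
  exists m1 m2, [/\ p@_m1 != 0, q@_m2 != 0 & m = (m1 + m2)%MM].
Proof.
rewrite -mcoeff_msupp => /msuppM_le /allpairsP[[m1 m2] /= [h1 h2 ->]].
by exists m1, m2; rewrite -!mcoeff_msupp.
Qed.

Lemma sum_supp (T : Type) (r : seq T) (G : T -> {mpoly K[n]}) m :
  (\sum_(x <- r) G x)@_m != 0 -> has (fun x => (G x)@_m != 0) r.
Proof.
rewrite (raddf_sum (mcoeff m)); apply: contraR; rewrite -all_predC.
elim: r => [|x r IHr]; first by rewrite big_nil.
by rewrite /= negbK big_cons => /andP[/eqP -> /IHr /eqP ->]; rewrite addr0.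
Qed.

Lemma ideal_span_monomials (M : set {mpoly K[n]}) (V : set 'X_{1..n}) p :
    (forall q, M q <-> exists2 u, V u & q = 'X_[u]) ->
  ideal_span M p <->
    (forall m, p@_m != 0 -> exists2 u, V u & (u <= m)%MM).
Proof.
move=> MV; split=> [[cs [csM ->]] m /sum_supp /hasP[cf /csM/MV[u Vu ->]] | H].
  rewrite mulrC mcoeffXM; case: ifP => [um _|]; last by rewrite eqxx.
  by exists u.
have /choice[h hP] : forall m, exists u, p@_m != 0 -> V u /\ (u <= m)%MM.
  move=> m; case: (boolP (p@_m != 0)) => [/H[u Vu um]|_]; last by exists m.
  by exists u.
exists [seq (p@_m *: 'X_[m - h m], 'X_[h m]) | m <- msupp p]; split.
  move=> cf /mapP[m]; rewrite mcoeff_msupp => /hP[Vh _] ->.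
  by apply/MV; exists (h m).
rewrite big_map [LHS]mpolyE !big_seq; apply: eq_bigr => m.
rewrite mcoeff_msupp => /hP[_ le] /=.
by rewrite -scalerAl -mpolyXD submK.
Qed.

Lemma monomial_complete_intersectionP I :
  monomial_complete_intersection I ->
  exists s, [/\ pairwise (@mcoprime n) s, ci_degrees s & is_monomial_ideal (up s) I].
Proof.
move=> [[M IM] In0 [g [ug gP greg]]].
have IMP p : I p <-> (forall m, p@_m != 0 -> exists2 u, M u & (u <= m)%MM).
  rewrite IM; apply: ideal_span_monomials => q.
  by split=> [[u Mu <-]|[u Mu ->]]; exists u.
have IX m : I 'X_[m] <-> exists2 u, M u & (u <= m)%MM.
  rewrite IMP; split=> [/(_ m)|h m']; rewrite mcoeffX.
    by rewrite eqxx oner_eq0; apply.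
  by case: (eqVneq m m') => [<-|]; rewrite ?eqxx.
(* Descent on the degree: a monomial of [I] that is not a minimal generator is properly divisible by
   another one. *)
have below m : I 'X_[m] -> up g m.
  have [k] := ubnP (mdeg m); elim: k m => // k IHk m /ltnSE le Im.
  case: (pselect (min_monomial_gen I m)) => [/gP mg | nmin].
    by apply/hasP; exists m => //; apply: lepm_refl.
  have [m' [Im' m'm ne]] : exists m', [/\ I 'X_[m'], (m' <= m)%MM & m' <> m].
    apply: contrapT => nex; apply: nmin; split=> // m' Im' m'm.
    by apply: contrapT => ne; apply: nex; exists m'.
  apply: (upset_up m'm); apply: IHk => //; apply: leq_trans le.
  by rewrite ltnNge; apply/negP => /(lem_mdeg_eq m'm).
have Ig : is_monomial_ideal (up g) I.
  move=> p; rewrite IMP; split=> H m /H; first by move/IX/below.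
  move=> /hasP[u /gP[/IX[u' Mu' u'u] _] um]; exists u' => //.
  exact: lepm_trans u'u um.
have gn0 : g != [::].
  apply/eqP => g0; apply: In0; apply/seteqP; split=> p.
    move/Ig => h; apply/mpolyP => m; rewrite mcoeff0; apply/eqP.
    by apply: contraT => /h; rewrite g0.
  by move=> ->; apply/Ig => m; rewrite mcoeff0 eqxx.
have gmin u v : u \in g -> v \in g -> (u <= v)%MM -> u = v.
  by move=> /gP[Iu _] /gP[_ vmin] /(vmin _ Iu).
exists g; split=> //; last first.
  (* If 1 is among the minimal generators, it divides all others and is the only one. *)
  case: (boolP (0%MM \in g)) => g0; [left | right; split=> //].
    have all0 u : u \in g -> u = 0%MM.
      by move=> ug'; rewrite (gmin _ _ g0 ug') //; apply/mnm_lepP => k; rewrite mnm0E.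
    case: g all0 ug gn0 {gP greg below Ig gmin g0} => //= u [|v g] all0.
      by rewrite (all0 u) // mem_head.
    have u0 : u = 0%MM by apply: all0; rewrite mem_head.
    have v0 : v = 0%MM by apply: all0; rewrite in_cons mem_head orbT.
    by rewrite u0 v0 in_cons eqxx.
  by apply/allP => u ug'; rewrite lt0n mdeg_eq0; apply: contraNneq g0 => <-.
apply/(pairwiseP 0%MM) => i j; rewrite !inE => ig jg ij.
set u := nth _ g i; set v := nth _ g j.
(* [w] is the gcd. Since [u] divides [(u / w) v], regularity puts [u / w] in the span of the
   generators before [v]; one of these divides [u / w], hence equals [u] by minimality, and
   [w = 1]. *)
pose w : 'X_{1..n} := [multinom minn (u k) (v k) | k < n].
have wu : (w <= u)%MM by apply/mnm_lepP => k; rewrite mnmE geq_minl.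
have wv : (w <= v)%MM by apply/mnm_lepP => k; rewrite mnmE geq_minr.
have spanP p : ideal_span [set` take j [seq 'X_[m] : {mpoly K[n]} | m <- g]]%classic p
    <-> forall m, p@_m != 0 -> exists2 a, (a \in take j g) & (a <= m)%MM.
  apply: (@ideal_span_monomials _ (fun a => a \in take j g)) => q.
  rewrite /= -map_take; split=> [/mapP[a at_ ->]|[a at_ ->]]; first by exists a.
  exact: map_f.
have /spanP/(_ (u - w)%MM) : ideal_span
    [set` take j [seq 'X_[m] : {mpoly K[n]} | m <- g]]%classic 'X_[u - w].
  apply: (greg j); first by rewrite size_map.
  rewrite (nth_map 0%MM) // -/v -mpolyXD.
  apply/spanP => m; rewrite -mcoeff_msupp msuppX inE => /eqP ->.
  exists u.
    by rewrite /u -(nth_take 0%MM ij); apply: mem_nth; rewrite size_take jg.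
  apply/mnm_lepP => k; have := mnm_lepP wu k; have := mnm_lepP wv k.
  by rewrite mnmDE mnmBE; lia.
rewrite mcoeffX eqxx oner_eq0 => /(_ isT)[a /mem_take ag au].
have e : a = u.
  by apply: gmin => //; [exact: mem_nth | exact: lepm_trans au (lem_subr _ _)].
apply/forallP => k; have := mnm_lepP au k; rewrite e mnmBE mnmE; lia.
Qed.

Lemma is_monomial_ideal_prod s t I J : is_monomial_ideal (up s) I ->
  is_monomial_ideal (up t) J ->
  is_monomial_ideal (up_prod s t) (ideal_prod I J).
Proof.
move=> Is Jt p; split=> [[cs [csP ->]] m /sum_supp/hasP[cf /csP[x Ix [y Jy <-]]] | H].
  move/mcoeffM_supp => [m1 [m2 [_ /mcoeffM_supp[a [b [xa yb ->]]] ->]]].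
  have /hasP[u us ua] := (Is x).1 Ix _ xa.
  have /hasP[v vt vb] := (Jt y).1 Jy _ yb.
  apply/hasP; exists u => //; apply/hasP; exists v => //.
  apply/mnm_lepP => k; rewrite !mnmDE.
  by have := mnm_lepP ua k; have := mnm_lepP vb k; lia.
have /choice[h hP] : forall m, exists h : 'X_{1..n} * 'X_{1..n}, p@_m != 0 ->
    [/\ h.1 \in s, h.2 \in t & (h.1 + h.2 <= m)%MM].
  move=> m; case: (boolP (p@_m != 0)) => [/H|_]; last by exists (m, m).
  by move=> /hasP[u us /hasP[v vt le]]; exists (u, v).
exists [seq (p@_m *: 'X_[m - ((h m).1 + (h m).2)], 'X_[(h m).1] * 'X_[(h m).2])
  | m <- msupp p]; split.
  move=> cf /mapP[m]; rewrite mcoeff_msupp => /hP[h1 h2 _] -> /=.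
  exists 'X_[(h m).1]; last exists 'X_[(h m).2] => //.
    apply/Is => m'; rewrite -mcoeff_msupp msuppX inE => /eqP ->.
    by apply/hasP; exists (h m).1 => //; apply: lepm_refl.
  apply/Jt => m'; rewrite -mcoeff_msupp msuppX inE => /eqP ->.
  by apply/hasP; exists (h m).2 => //; apply: lepm_refl.
rewrite big_map [LHS]mpolyE !big_seq; apply: eq_bigr => m.
rewrite mcoeff_msupp => /hP[_ _ le] /=.
by rewrite -scalerAl -!mpolyXD submK.
Qed.

Lemma is_monomial_ideal_inter s t I J : is_monomial_ideal (up s) I ->
  is_monomial_ideal (up t) J ->
  is_monomial_ideal (fun m => up s m && up t m) (I `&` J)%classic.
Proof.
move=> Is Jt p; split=> [[/Is sp /Jt tp] m nz | H]; first by rewrite sp ?tp.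
by split; [apply/Is | apply/Jt] => m /H /andP[].
Qed.

End CompleteIntersections.

Local Open Scope classical_set_scope.

Theorem theorem1p1 (K : fieldType) (n : nat) (I J : set {mpoly K[n]})
    (hI : monomial_complete_intersection I)
    (hJ : monomial_complete_intersection J) :
  reg (ideal_prod I J) <= reg I + reg J /\ reg (I `&` J) <= reg I + reg J.
Proof.
have [s [cs ds Is]] := monomial_complete_intersectionP hI.
have [t [ct dt Jt]] := monomial_complete_intersectionP hJ.
rewrite (reg_coprime cs ds Is) (reg_coprime ct dt Jt) -PoszD; split.
  by apply: reg_le_reg (is_monomial_ideal_prod Is Jt) _; apply: reg_le_prod.
by apply: reg_le_reg (is_monomial_ideal_inter Is Jt) _; apply: reg_le_inter.
Qed.
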